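(* Consider the impulsive control system $$\dot x(t)=f(x(t)),\ t\neq t_k+\tau;\qquad \Delta x(t_k+\tau)=g(x(t_k)),\ k\in\mathbb{N};\qquad x(0)=x_0,$$ with the event times $\{t_k\}_{k\in\mathbb{N}}$ determined, for positive constants $a$ and $b$ and a sampling period $\delta>0$, by $$t_{1}=\inf\{j\delta\ge 0: j\in\mathbb{N},\ V(x(j\delta))\ge a e^{-bj\delta}\},\qquad t_{k+1}=\inf\{j\delta\ge t_k+\tau: j\in\mathbb{N},\ V(x(j\delta))\ge a e^{-bj\delta}\}\ \text{ for } k\ge 1 .$$ Suppose that there exists some $R>0$ such that Assumptions A and B (stated in the context) hold on $\mathcal{B}(R)$, with the constants $L_1,L_2,\mu,\rho>0$ and functions $V\in\mathcal V$, $\alpha_1,\alpha_2\in\mathcal{K}_\infty$ appearing there. If $\mu$, $\rho$, $a$, $\tau$ and $\delta$ satisfy $$\max\left\{e^{(\mu+b)\delta},\,e^{\mu(\tau+\delta)}\right\}\le\frac{\alpha_1(R)}{a},\qquad \rho\, e^{b(\tau+\delta)}e^{\mu\delta}<1,$$ and $$L_2+\sqrt{\frac{\tau L_1\left(e^{2L_1\tau}-1\right)}{2}}<\frac{R}{\alpha_1^{-1}(\bar a)}\qquad\text{with }\ \bar a:=a e^{(\mu+b)\delta},$$ then, for any initial state $x_0\in\mathcal{B}(\alpha_2^{-1}(a))$, the inter-event times $\{t_{k+1}-t_k\}_{k\in\mathbb{N}}$ are bigger than $$\Gamma:=\tau-\frac{\ln\left(\rho\, e^{b(\tau+\delta)}e^{\mu\delta}\right)}{b+\mu}>\tau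 .$$ Moreover, the trivial solution of the system is asymptotically stable.
   Context: Notation. $\mathbb{N}$ is the set of positive integers, $\mathbb{R}^+=[0,\infty)$, $\|\cdot\|$ is the Euclidean norm on $\mathbb{R}^n$, and $\mathcal{B}(r)=\{x\in\mathbb{R}^n:\|x\|<r\}$. $\mathcal V$ is the set of locally Lipschitz continuous functions $\mathbb{R}^n\to\mathbb{R}^+$. A continuous function $\alpha:\mathbb{R}^+\to\mathbb{R}^+$ is of class $\mathcal{K}_\infty$ if it is strictly increasing, $\alpha(0)=0$, and $\alpha(s)\to\infty$ as $s\to\infty$; $\alpha^{-1}$ denotes its inverse. System. $x(t)\in\mathbb{R}^n$ is the state, $x_0\in\mathbb{R}^n$ the initial state, $f:\mathbb{R}^n\to\mathbb{R}^n$ is continuous with $f(0)=0$, $g:\mathbb{R}^n\to\mathbb{R}^n$ satisfies $g(0)=0$, and $\tau\in\mathbb{R}^+$ is the actuation delay. The times $t_k$ are the event times (the impulsive control input is updated), and the times $t_k+\tau$ are the impulse times (the state jumps). $\Delta x(t):=x(t^+)-x(t^-)$, where $x(t^+)$ and $x(t^-)$ are the right and left limits; $x$ is right continuous at each impulse time, so $x(t_k+\tau)=x((t_k+\tau)^-)+g(x(t_k))$; when $\tau=0$ this is read with the pre-jump state, $x(t_k)=x(t_k^-)+g(x(t_k^-))$. The function $V$ in the event-time rule is the one in Assumption B. The infimum of the empty set is $\infty$; if $t_{k+1}=\infty$, no further events or impulses occur after time $t_k+\tau$ (none at all if $t_1=\infty$), and the inter-event bounds concern events that actually occur. The event times depend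 on the solution, hence on $x_0$. Dini derivative. For $V\in\mathcal V$, $\mathrm{D}^+V(x)=\limsup_{h\to0^+}\frac{V(x+hf(x))-V(x)}{h}$. Assumption A (on $\mathcal{B}(R)$). There exist positive constants $L_1$ and $L_2$ such that for all $x\in\mathcal{B}(R)$: $\|f(x)\|\le L_1\|x\|$ and $\|x+g(x)\|\le L_2\|x\|$. Assumption B (on $\mathcal{B}(R)$). There exist $V\in\mathcal V$, $\alpha_1,\alpha_2\in\mathcal{K}_\infty$, and positive constants $\mu$ and $\rho$ such that for any $x\in\mathcal{B}(R)$: (i) $\alpha_1(\|x\|)\le V(x)\le\alpha_2(\|x\|)$; (ii) $\mathrm{D}^+V(x)\le\mu V(x)$; (iii) if $y\in\mathcal{B}(R)$ and $y+g(x)\in\mathcal{B}(R)$, then $V(y+g(x))\le\rho V(x)$, where $y=z(\tau)$ and $z(t)$ is the solution of the initial value problem $\dot z(t)=f(z(t))$, $z(0)=x$. Stability. Write $x(t)=x(t,0,x_0)$ for the solution of the system. The trivial solution is stable if for any $\varepsilon>0$ there exists $\sigma=\sigma(\varepsilon)>0$ such that $\|x_0\|<\sigma$ implies $\|x(t)\|<\varepsilon$ for all $t\ge0$. It is asymptotically stable if it is stable and there exists $\sigma>0$ such that $\|x_0\|<\sigma$ implies $\lim_{t\to\infty}\|x(t)\|=0$. *)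

(* Defs.v *)
From HB Require Import structures.
From mathcomp Require Import all_boot all_order all_algebra.
From mathcomp Require Import all_classical all_reals all_analysis.
Import Order.TTheory GRing.Theory Num.Theory.
Import numFieldNormedType.Exports.

Set Implicit Arguments.
Unset Strict Implicit.
Unset Printing Implicit Defensive.

Local Open Scope classical_set_scope.
Local Open Scope ring_scope.

(* The canonical norm `|x| on 'rV[R]_n is the sup norm; it induces the same
   topology, so continuity, limits, derivatives and local Lipschitz continuity
   are taken from the library, while all bounds use the Euclidean norm. *)
Definition enorm (R : realType) (n : nat) (x : 'rV[R]_n) : R :=
  Num.sqrt (\sum_(i < n) x ord0 i ^+ 2).

Definition eball (R : realType) (n : nat) (r : R) : set 'rV[R]_n :=
  [set x | enorm x < r].

Definition class_V (R : realType) (n : nat) (V : 'rV[R]_n -> R) : Prop :=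
  (forall x, 0 <= V x) /\
  (forall x : 'rV[R]_n, exists2 U : set 'rV[R]_n, nbhs x U & [lipschitz V y | y in U]).

(* Functions R^+ -> R^+ are represented by total functions on R of which only
   the values on [0, +oo) matter. *)
Definition class_Kinfty (R : realType) (alpha : R -> R) : Prop :=
  [/\ {within [set s : R | 0 <= s], continuous alpha},
      {in [pred s : R | 0 <= s] &, {homo alpha : s t / s < t}},
      alpha 0 = 0 &
      alpha s @[s --> +oo%R] --> +oo%R].

Definition Kinv (R : realType) (alpha : R -> R) : R -> R :=
  'pinv_(fun=> 0) [set s : R | 0 <= s] alpha.

Definition dini (R : realType) (n : nat) (f : 'rV[R]_n -> 'rV[R]_n)
    (V : 'rV[R]_n -> R) (x : 'rV[R]_n) : \bar R :=
  limf_esup (fun h : R => ((V (x + h *: f x) - V x) / h)%:E) (0 : R)^'+.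

Definition assumptionA (R : realType) (n : nat) (f g : 'rV[R]_n -> 'rV[R]_n)
    (r L1 L2 : R) : Prop :=
  [/\ 0 < L1, 0 < L2 &
      forall x, eball r x ->
        enorm (f x) <= L1 * enorm x /\ enorm (x + g x) <= L2 * enorm x].

Definition ivp_solution (R : realType) (n : nat) (f : 'rV[R]_n -> 'rV[R]_n)
    (c : R) (x : 'rV[R]_n) (z : R -> 'rV[R]_n) : Prop :=
  [/\ z 0 = x,
      {within `[0, c], continuous z} &
      forall t, 0 < t < c -> is_derive t 1 z (f (z t))].

(* f is only continuous, so the solution z of the initial value problem need
   not be unique: (iii) is required of each of them. *)
Definition assumptionB (R : realType) (n : nat) (f g : 'rV[R]_n -> 'rV[R]_n)
    (tau r : R) (V : 'rV[R]_n -> R) (alpha1 alpha2 : R -> R) (mu rho : R)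
    : Prop :=
  [/\ class_V V, class_Kinfty alpha1, class_Kinfty alpha2,
      0 < mu /\ 0 < rho &
      forall x, eball r x ->
      [/\ alpha1 (enorm x) <= V x <= alpha2 (enorm x),
          (dini f V x <= (mu * V x)%:E)%E &
          forall z, ivp_solution f tau x z ->
            eball r (z tau) -> eball r (z tau + g x) ->
            V (z tau + g x) <= rho * V x]].

Section system.
Variables (R : realType) (n : nat).
Variables (f g : 'rV[R]_n -> 'rV[R]_n) (V : 'rV[R]_n -> R).
Variables (a b delta tau : R).
Implicit Types (x : R -> 'rV[R]_n) (T lo : \bar R).

(* State seen at an event time s by the impulse that it triggers.  For tau = 0
   the impulse takes place at s itself, and x is right continuous there, so the
   state before the jump is the left limit. *)
Definition prejump x (s : R) : 'rV[R]_n :=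
  if tau == 0 then lim (x @ s^'-) else x s.

(* A trajectory lives on [0, T), T <= +oo, so only sampling times before T are
   tested.  If tau = 0, the test at a sampling time uses the state before the
   jump this test may trigger: the left limit, except at the previous impulse
   time lo itself, where it is the value x lo after the previous jump. *)
Definition next_event x T lo : \bar R :=
  ereal_inf [set (j%:R * delta)%:E | j in [set j : nat |
    [/\ (0 < j)%N,
        (lo <= (j%:R * delta)%:E < T)%E &
        a * expR (- (b * (j%:R * delta)))
          <= V (if (lo < (j%:R * delta)%:E)%E then prejump x (j%:R * delta)
                else x (j%:R * delta))]]].

(* event_time x T k is t_{k+1}; it is +oo if there is no such event. *)
Fixpoint event_time x T (k : nat) : \bar R :=
  if k is k'.+1 then next_event x T (event_time x T k' + tau%:E)%E
  else next_event x T 0%E.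

Definition solution T x (x0 : 'rV[R]_n) : Prop :=
  [/\ (0 < T)%E,
      x 0 = x0 /\ x s @[s --> 0^'+] --> x 0,
      forall t : R, 0 < t -> (t%:E < T)%E ->
        (forall k, (event_time x T k + tau%:E)%E != t%:E) ->
        is_derive t 1 x (f (x t)) &
      forall k (s : R), event_time x T k = s%:E -> ((s + tau)%:E < T)%E ->
        [/\ cvg (x @ (s + tau)^'-),
            x u @[u --> (s + tau)^'+] --> x (s + tau) &
            x (s + tau) - lim (x @ (s + tau)^'-) = g (prejump x s)]].

(* "The solution x(t, 0, x0)" is any solution that cannot be continued. *)
Definition maximal_solution T x (x0 : 'rV[R]_n) : Prop :=
  solution T x x0 /\
  forall T' x', solution T' x' x0 -> (T <= T')%E ->
    (forall t : R, 0 <= t -> (t%:E < T)%E -> x' t = x t) -> T' = T.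

Definition stable : Prop :=
  forall eps : R, 0 < eps -> exists2 sigma : R, 0 < sigma &
    forall x0 : 'rV[R]_n, enorm x0 < sigma -> forall T x, maximal_solution T x x0 ->
      T = +oo%E /\ forall t : R, 0 <= t -> enorm (x t) < eps.

Definition asymptotically_stable : Prop :=
  stable /\
  exists2 sigma : R, 0 < sigma &
    forall x0 : 'rV[R]_n, enorm x0 < sigma -> forall T x, maximal_solution T x x0 ->
      T = +oo%E /\ enorm (x t) @[t --> +oo%R] --> (0 : R).

End system.

(* Main.v *)
Require Import Defs.
From mathcomp Require Import all_boot all_order all_algebra.
From mathcomp Require Import all_classical all_reals all_analysis.
From mathcomp Require Import ring lra.
Import Order.TTheory GRing.Theory Num.Theory.
Import numFieldNormedType.Exports.

Local Open Scope classical_set_scope.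
Local Open Scope ring_scope.

(* Between two impulses, [V] grows along the solution at most like [expR (mu * t)]
   (comparison with the Dini derivative).  A state below the threshold
   [a * expR (- (b * t))] at a sampling time therefore stays below
   [a * expR ((mu + b) * delta) * expR (- (b * t))] until the next sampling time,
   hence in the ball; the second bound in the maximum keeps the state in the ball
   during the actuation delay, and the condition on [L2] makes it land in the ball
   after the impulse.  By (iii), the value of [V] after the impulse is below
   [q = rho * expR (b * (tau + delta)) * expR (mu * delta) < 1] times the threshold,
   so the threshold is reached again only after a time [- ln q / (b + mu)].  Thus
   [V] decays like [expR (- (b * t))], which gives attractivity; for stability, a
   solution started close to the origin triggers no event until the decaying bound
   is small.  Since [f] is only continuous, that a maximal solution is global rests
   on Peano's theorem: a solution on a bounded interval has a left limit and
   is continued from there, with the impulse that is due, if any. *)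

(** * Dini inequalities *)

(** The delicate point is what is read at an event time. With [tau = 0] the state at that time is
    already the one after the jump, and the test bears on the left limit. Estimates up to an event
    are therefore stated for left limits, along solutions whose value at the right end point is
    replaced by the limit; this treats [tau = 0] and [tau > 0] together. The invariant at the start
    of a segment is a strict inequality, so no event recurs at an impulse time; this yields the gap,
    excludes accumulation of events, and lets finitely many segments reach any time. All of this is
    proved on [[0, T)], before [T = +oo] is known. Extending past a finite [T] meets a circularity:
    event times are computed from the trajectory and from [T], so those of the continuation must be
    compared with the original ones. Causality resolves it: an event before the end point, and with
    [tau = 0] also at it, is decided by the past alone. *)

Lemma at_rightE {R : realType} (u : R) (P : set R) :
  (\forall v \near u^'+, P v) <->
  exists2 d, 0 < d & forall v, u < v < u + d -> P v.
Proof.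
split.
  move=> /nbhs_ballP[d /= d0 H]; exists d => // v /andP[uv vd].
  by apply: H => //; rewrite /ball /= ltr0_norm ?subr_lt0// opprB ltrBlDl.
move=> [d d0 H]; near=> v; apply: H; apply/andP; split => //.
by near: v; apply: nbhs_right_lt; rewrite ltrDl.
Unshelve. all: by end_near. Qed.

(** Let [s] be the supremum of the points up to which [P] holds throughout. Closure from the left
    gives [P s]; if [s < q], openness to the right would push the set beyond [s]. *)
Lemma real_induction {R : realType} (p q : R) (P : R -> Prop) : p <= q -> P p ->
  (forall u, p <= u < q -> P u -> \forall v \near u^'+, P v) ->
  (forall u, p < u <= q -> (forall v, p <= v < u -> P v) -> P u) ->
  forall u, p <= u <= q -> P u.
Proof.
move=> pq Pp Pright Pleft.
pose S := [set u | p <= u <= q /\ forall v, p <= v <= u -> P v].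
have Sp : S p.
  by split=> [|v]; rewrite ?lexx ?pq// => /le_anti <-.
have supS : has_sup S by split; [exists p|exists q => u [/andP[]]].
set s := sup S.
have ps : p <= s by apply: ub_le_sup => //; case: supS.
have sq : s <= q by apply: ge_sup; [exists p|move=> u [/andP[]]].
have Ps v : p <= v < s -> P v.
  move=> /andP[pv vs].
  have [w [_ Pw] vw] : exists2 w, S w & v < w.
    have /sup_adherent /(_ supS)[w Sw] : 0 < s - v by rewrite subr_gt0.
    by rewrite -/s subKr; exists w.
  by apply: Pw; rewrite pv ltW.
have Pss : P s.
  move: ps; rewrite le_eqVlt => /orP[/eqP <-//|ps].
  by apply: Pleft => //; rewrite ps.
have Ps' v : p <= v <= s -> P v.
  by rewrite (le_eqVlt v) => /andP[pv /orP[/eqP->//|vs]]; apply: Ps; rewrite pv.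
suff <- : s = q by [].
apply/eqP; rewrite eq_le sq leNgt; apply/negP => sltq.
have /at_rightE[d d0 Pd] : \forall v \near s^'+, P v by apply: Pright => //; rewrite ps.
pose w := Num.min (s + d / 2) q.
have sw : s < w by rewrite lt_min sltq ltrDl divr_gt0.
suff : S w by move/(ub_le_sup supS.2); rewrite leNgt sw.
split=> [|v /andP[pv vw]].
  by rewrite ge_min lexx orbT andbT (le_trans ps)// ltW.
have [vs|sv] := leP v s; first by apply: Ps'; rewrite pv.
apply: Pd; rewrite sv (le_lt_trans vw)// gt_min ltrD2l.
by rewrite gtr_pMr// invf_lt1 ?ltr1n.
Qed.

Lemma within_itvP {R : realType} {W : normedModType R} (p q : R) (z : R -> W) :
  {within `[p, q], continuous z} <->
  forall u, p <= u <= q -> forall e, 0 < e -> exists2 d, 0 < d &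
    forall v, p <= v <= q -> `|v - u| < d -> `|z v - z u| < e.
Proof.
rewrite subspace_continuousP; split => H u.
  move=> upq e e0; have := H u; rewrite /= in_itv/= => /(_ upq).
  move=> /cvgrPdist_lt/(_ _ e0)/nbhs_ballP[d /= d0 D]; exists d => // v vpq vu.
  by rewrite distrC; apply: D; rewrite /ball/= ?in_itv// distrC.
rewrite /= in_itv/= => upq; apply/cvgrPdist_lt => e e0.
have [d d0 D] := H u upq e e0.
apply/nbhs_ballP; exists d => // v /= vu; rewrite in_itv/= => vpq.
by rewrite distrC; apply: D => //; rewrite distrC.
Qed.

(** Allowing a slope [e > 0] makes the estimate propagate by [real_induction]. The slope at [p] is
    not controlled, so the induction starts at an interior [s], and continuity at [p] absorbs the
    difference. *)
Lemma dini_nonincreasing {R : realType} (p q : R) (phi : R -> R) : p <= q ->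
  {within `[p, q], continuous phi} ->
  (forall u, p < u < q -> forall e, 0 < e ->
     \forall v \near u^'+, phi v <= phi u + e * (v - u)) ->
  phi q <= phi p.
Proof.
rewrite le_eqVlt => /orP[/eqP->//|pq] /within_itvP cphi dphi.
have step e s : 0 < e -> p < s < q -> phi q <= phi s + e * (q - s).
  move=> e0 /andP[ps sq].
  apply: (@real_induction _ s q (fun v => phi v <= phi s + e * (v - s))).
  - exact: ltW.
  - by rewrite subrr mulr0 addr0.
  - move=> u /andP[su uq] Pu.
    have := dphi u; rewrite (lt_le_trans ps su) uq => /(_ isT e e0).
    apply: filterS => v /le_trans; apply; lra.
  - move=> u /andP[su uq] Pv; apply/ler_addgt0Pr => k k0.
    have /cphi/(_ k k0)[d d0 D] : p <= u <= q by rewrite (ltW (lt_trans ps su)).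
    pose v := Num.max s (u - d / 2).
    have vu : v < u by rewrite gt_max su gtrBl divr_gt0.
    have sv : s <= v by rewrite le_max lexx.
    have dv : u - d / 2 <= v by rewrite le_max lexx orbT.
    have := D v; rewrite (le_trans (ltW ps) sv) (le_trans (ltW vu) uq) => /(_ isT).
    rewrite ltr0_norm ?subr_lt0// => /(_ ltac:(lra)).
    rewrite ltr_norml => /andP[D1 _].
    have := Pv v; rewrite sv vu => /(_ isT) Pv'.
    have : e * (v - s) <= e * (u - s) by rewrite ler_pM2l// lerD2r ltW.
    lra.
  - by rewrite lexx ltW.
apply/ler_addgt0Pr => k k0.
have k20 : 0 < k / 2 by rewrite divr_gt0.
have /cphi/(_ _ k20)[d d0 D] : p <= p <= q by rewrite lexx ltW.
pose s := Num.min (p + d / 2) ((p + q) / 2).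
have sd : s <= p + d / 2 by rewrite ge_min lexx.
have ps : p < s by rewrite lt_min; apply/andP; split; lra.
have sq : s < q by rewrite gt_min; apply/orP; right; lra.
have := D s; rewrite (ltW ps) (ltW sq) => /(_ isT).
rewrite gtr0_norm ?subr_gt0// => /(_ ltac:(lra)).
rewrite ltr_norml => /andP[_ D2].
have qp0 : 0 < q - p by rewrite subr_gt0.
(* This slope costs at most [k / 2] over the whole interval; the other half pays for moving from [p]
   to [s]. *)
have := @step (k / 2 / (q - p)) s (divr_gt0 k20 qp0); rewrite ps sq => /(_ isT).
have : k / 2 / (q - p) * (q - s) <= k / 2.
  rewrite mulrAC ler_pdivrMr// ler_pM2l//; lra.
lra.
Qed.

(* Multiplying by [expR (- mu * u)] reduces to the case [mu = 0], as
   [1 + mu * h <= expR (mu * h)]. *)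
Lemma dini_growth {R : realType} (p q mu : R) (psi : R -> R) : p <= q -> 0 <= mu ->
  {within `[p, q], continuous psi} -> (forall u, p <= u <= q -> 0 <= psi u) ->
  (forall u, p < u < q -> forall e, 0 < e ->
     \forall v \near u^'+, psi v <= psi u + (mu * psi u + e) * (v - u)) ->
  psi q <= psi p * expR (mu * (q - p)).
Proof.
move=> pq mu0 cpsi psi0 dpsi.
pose phi u := psi u * expR (- (mu * (u - p))).
suff : phi q <= phi p.
  rewrite /phi subrr mulr0 oppr0 expR0 mulr1 expRN.
  by rewrite ler_pdivrMr// expR_gt0.
apply: dini_nonincreasing => //.
  move=> u; apply: cvgM; first exact: cpsi.
  apply: continuous_subspaceT => {}u.
  apply: continuous_comp; last exact: continuous_expR.
  apply: cvgN; apply: cvgMl_tmp; apply: cvgB => //; exact: cvg_cst.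
move=> u /andP[pu uq] e e0.
have := dpsi u; rewrite pu uq => /(_ isT e e0) H.
near=> v.
have uv : u < v by near: v; exact: nbhs_right_gt.
have vq : v < q by near: v; exact: nbhs_right_lt.
have Hv : psi v <= psi u + (mu * psi u + e) * (v - u) by near: v.
have psiu : 0 <= psi u by apply: psi0; rewrite !ltW.
rewrite /phi.
have -> : - (mu * (v - p)) = - (mu * (u - p)) + - (mu * (v - u)) by lra.
rewrite expRD mulrCA (mulrC (psi u)).
set E := expR (- (mu * (u - p))).
have E0 : 0 <= E by exact: expR_ge0.
have E1 : E <= 1 by rewrite -expR0 ler_expR oppr_le0 mulr_ge0// subr_ge0 ltW.
set F := expR _.
have F0 : 0 < F by exact: expR_gt0.
have F1 : F <= 1 by rewrite -expR0 ler_expR oppr_le0 mulr_ge0// subr_ge0 ltW.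
have F2 : (1 + mu * (v - u)) * F <= 1.
  by rewrite /F expRN ler_pdivrMr ?expR_gt0// mul1r expR_ge1Dx.
have A : psi v * F <= psi u + e * (v - u).
  have : psi v * F <= (psi u + (mu * psi u + e) * (v - u)) * F by rewrite ler_pM2r.
  have : psi u * ((1 + mu * (v - u)) * F) <= psi u * 1 by rewrite ler_wpM2l.
  have : e * (v - u) * F <= e * (v - u) * 1.
    by rewrite ler_wpM2l// mulr_ge0 ?ltW// subr_gt0.
  by lra.
have : E * (psi v * F) <= E * (psi u + e * (v - u)) by rewrite ler_wpM2l.
have : E * (e * (v - u)) <= 1 * (e * (v - u)).
  by rewrite ler_wpM2r// mulr_ge0 ?ltW// subr_gt0.
lra.
Unshelve. all: by end_near. Qed.

(** * The Euclidean norm and derivatives *)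

Section enorm.
Context {R : realType} {n : nat}.
Implicit Types x y : 'rV[R]_n.

Lemma enorm_ge0 x : 0 <= enorm x. Proof. exact: sqrtr_ge0. Qed.

Lemma enorm0 : enorm (0 : 'rV[R]_n) = 0.
Proof.
by rewrite /enorm big1 ?sqrtr0// => i _; rewrite mxE expr0n.
Qed.

Let sqsum_ge0 x : 0 <= \sum_(i < n) x ord0 i ^+ 2.
Proof. by apply: sumr_ge0 => i _; exact: sqr_ge0. Qed.

Lemma enormZ c x : enorm (c *: x) = `|c| * enorm x.
Proof.
rewrite /enorm -sqrtr_sqr -sqrtrM ?sqr_ge0// mulr_sumr; congr Num.sqrt.
by apply: eq_bigr => i _; rewrite mxE exprMn.
Qed.

Lemma enormN x : enorm (- x) = enorm x.
Proof. by rewrite -scaleN1r enormZ normrN1 mul1r. Qed.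

Lemma enorm_distC x y : enorm (x - y) = enorm (y - x).
Proof. by rewrite -enormN opprB. Qed.

(** Cauchy-Schwarz, by summing the squares of [c * u - d * v] with [c] and [d] the norms of [y] and
    [x]. The product of the norms is cancelled at the end, hence the separate case where it
    vanishes. *)
Lemma le_dot_enorm x y : \sum_(i < n) x ord0 i * y ord0 i <= enorm x * enorm y.
Proof.
rewrite /enorm; set A := \sum_(i < n) x _ _ ^+ 2; set B := \sum_(i < n) y _ _ ^+ 2.
set D := \sum_(i < n) _.
have key c d : c * d * D *+ 2 <= c ^+ 2 * A + d ^+ 2 * B.
  rewrite !mulr_sumr -sumrMnl -big_split/=; apply: ler_sum => i _.
  rewrite -subr_ge0; set u := x _ _; set v := y _ _.
  have -> : c ^+ 2 * u ^+ 2 + d ^+ 2 * v ^+ 2 - c * d * (u * v) *+ 2 =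
    (c * u - d * v) ^+ 2 by ring.
  exact: sqr_ge0.
have A0 : 0 <= A by exact: sqsum_ge0.
have B0 : 0 <= B by exact: sqsum_ge0.
have := key (Num.sqrt B) (Num.sqrt A); rewrite !sqr_sqrtr//.
have [AB|AB] := eqVneq (Num.sqrt A * Num.sqrt B) 0.
  move=> _; rewrite AB.
  move: AB => /eqP; rewrite mulf_eq0 !sqrtr_eq0 => /orP[] /[dup] ? le0.
    have A00 : A = 0 by apply/eqP; rewrite eq_le le0.
    rewrite /D big1// => i _.
    have : x ord0 i ^+ 2 = 0.
      by apply: (psumr_eq0P _ A00) => // j _; exact: sqr_ge0.
    by move/eqP; rewrite sqrf_eq0 => /eqP ->; rewrite mul0r.
  have B00 : B = 0 by apply/eqP; rewrite eq_le le0.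
  rewrite /D big1// => i _.
  have : y ord0 i ^+ 2 = 0.
    by apply: (psumr_eq0P _ B00) => // j _; exact: sqr_ge0.
  by move/eqP; rewrite sqrf_eq0 => /eqP ->; rewrite mulr0.
have P0 : 0 < Num.sqrt A * Num.sqrt B by rewrite lt_def AB mulr_ge0// sqrtr_ge0.
rewrite (mulrC B) -mulr2n => H.
rewrite -(ler_pM2l P0).
have -> : Num.sqrt A * Num.sqrt B * (Num.sqrt A * Num.sqrt B) = A * B.
  by rewrite mulrACA -!expr2 !sqr_sqrtr.
by move: H; rewrite lerMn2r/= (mulrC (Num.sqrt B)).
Qed.

Lemma ler_enormD x y : enorm (x + y) <= enorm x + enorm y.
Proof.
rewrite -(ler_sqr) ?nnegrE ?addr_ge0 ?enorm_ge0//.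
rewrite sqrrD {1}/enorm sqr_sqrtr//.
have -> : \sum_(i < n) (x + y) ord0 i ^+ 2 = \sum_(i < n) x ord0 i ^+ 2 +
   (\sum_(i < n) x ord0 i * y ord0 i) *+ 2 + \sum_(i < n) y ord0 i ^+ 2.
  rewrite -sumrMnl -!big_split/=; apply: eq_bigr => i _.
  by rewrite mxE sqrrD.
rewrite /enorm !sqr_sqrtr// lerD2r lerD2l lerMn2r/=.
exact: le_dot_enorm.
Qed.

Lemma ler_enorm_dist x y : enorm x <= enorm y + enorm (x - y).
Proof. by rewrite -{1}(subrK y x) addrC ler_enormD. Qed.

Lemma norm_le_enorm x : `|x| <= enorm x.
Proof.
rewrite /Num.norm/= mx_normrE; apply/bigmax_leP; split; first exact: enorm_ge0.
move=> [i j] _ /=; rewrite -sqrtr_sqr ler_sqrt ?sqsum_ge0//.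
by rewrite (ord1 i) (bigD1 j)//= lerDl sumr_ge0// => k _; exact: sqr_ge0.
Qed.

Lemma coord_le_norm x i : `|x ord0 i| <= `|x|.
Proof.
by rewrite [leRHS]/Num.norm/= mx_normrE; apply/bigmax_geP; right; exists (ord0, i).
Qed.

Lemma enorm_le_norm x : enorm x <= n%:R * `|x|.
Proof.
rewrite -[leRHS]ger0_norm ?mulr_ge0// -sqrtr_sqr ler_sqrt ?sqr_ge0//.
rewrite exprMn (@le_trans _ _ (n%:R * `|x| ^+ 2))//.
  rewrite -[X in X%:R * _](card_ord n) mulr_natl -sumr_const.
  by apply: ler_sum => i _; rewrite -real_normK ?num_real// lerXn2r ?nnegrE// coord_le_norm.
rewrite ler_wpM2r ?sqr_ge0// -natrX ler_nat.
by case: (n) => // m; rewrite leq_pmulr.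
Qed.

Lemma enorm_continuous : continuous (@enorm R n).
Proof.
move=> x; apply/(@cvgrPdist_lt _ _ _ _ (nbhs_filter x)) => e e0.
(* [n.+1] rather than [n] keeps the divisor positive in dimension 0. *)
have n0 : 0 < (n.+1%:R : R) by rewrite ltr0n.
apply/nbhs_ballP; exists (e / n.+1%:R) => /=; first exact: divr_gt0.
move=> y; rewrite -ball_normE /ball_/= ltr_pdivlMr// => yx.
have H : enorm (x - y) < e.
  apply: le_lt_trans yx; rewrite (le_trans (enorm_le_norm _))// mulrC.
  by rewrite ler_wpM2l// ler_nat.
rewrite (le_lt_trans _ H)// ler_norml; apply/andP; split.
  by have := ler_enorm_dist y x; rewrite (enorm_distC y); lra.
by have := ler_enorm_dist x y; lra.
Qed.

End enorm.

Section derivative.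
Context {R : realType} {W : normedModType R}.
Implicit Types (z : R -> W) (t : R) (d : W).

(** Without a quotient, the condition can be restricted to one side of [t], or proved on each side
    separately, as in [peano] and [flow_glue]. *)
Lemma is_derive1P z t d : is_derive t 1 z d <->
  forall e, 0 < e -> \forall v \near t, `|z v - z t - (v - t) *: d| <= e * `|v - t|.
Proof.
have key v : v != t ->
    z v - z t - (v - t) *: d = - ((v - t) *: (d - (v - t)^-1 *: (z v - z t))).
  by rewrite -subr_eq0 => vt; rewrite scalerBr scalerA divff// scale1r opprB.
split.
  move=> [dz dzE] e e0; rewrite /derivable -/(derive z t 1) in dz.
  have /cvgrPdist_le/(_ e e0)/nbhs_ballP[k /= k0 H] := dz.
  apply/nbhs_ballP; exists k => //= v vk.
  have [->|vt] := eqVneq v t; first by rewrite !subrr scale0r subr0 !normr0 mulr0.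
  rewrite key// normrN normrZ mulrC ler_wpM2r//.
  have := H (v - t); rewrite /shift/= [_ *: 1]mulr1 subrK subr_eq0 -dzE; apply => //.
  by rewrite /ball/= sub0r normrN distrC.
move=> H.
have cv : (fun h => h^-1 *: ((z \o shift t) (h *: 1) - z t)) @ (0 : R)^' --> d.
  apply/cvgrPdist_le => e e0.
  have /nbhs_ballP[k /= k0 {}H] := H _ e0.
  apply/nbhs_ballP; exists k => //= h hk h0; rewrite [_ *: 1]mulr1.
  have := H (h + t); rewrite /ball/= opprD addrCA subrr addr0 normrN.
  rewrite /ball/= sub0r normrN in hk; move=> /(_ hk).
  rewrite key; last by rewrite -subr_eq0 addrK.
  by rewrite addrK normrN normrZ mulrC ler_pM2r// normr_gt0.
split; first by apply/cvg_ex; exists d.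
exact: cvg_lim cv.
Qed.

Lemma is_derive1_right z t d : is_derive t 1 z d ->
  forall e, 0 < e -> \forall v \near t^'+, `|z v - z t - (v - t) *: d| <= e * (v - t).
Proof.
move=> /is_derive1P H e e0.
near=> v.
have tv : t < v by near: v; exact: nbhs_right_gt.
have : `|z v - z t - (v - t) *: d| <= e * `|v - t|.
  by near: v; apply: cvg_within; exact: H.
by rewrite gtr0_norm// subr_gt0.
Unshelve. all: by end_near. Qed.

Lemma is_derive1_continuous z t d : is_derive t 1 z d -> z u @[u --> t] --> z t.
Proof.
move=> dz; have [+ _] := dz; by move=> /derivable1_diffP/differentiable_continuous.
Qed.

End derivative.

(** * Comparison along solutions *)

Section class_Kinfty.
Context {R : realType} (alpha : R -> R) (Kalpha : class_Kinfty alpha).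

Lemma Kinfty_lt s t : 0 <= s -> 0 <= t -> (alpha s < alpha t) = (s < t).
Proof.
have [_ inc _ _] := Kalpha; move=> s0 t0; apply/idP/idP; last exact: inc.
by apply: contraTT; rewrite -!leNgt le_eqVlt => /predU1P[->//|ts]; exact/ltW/inc.
Qed.

Lemma Kinfty_le s t : 0 <= s -> 0 <= t -> (alpha s <= alpha t) = (s <= t).
Proof. by move=> s0 t0; rewrite !leNgt Kinfty_lt. Qed.

Lemma Kinfty_gt0 s : 0 < s -> 0 < alpha s.
Proof.
by have [_ _ alpha0 _] := Kalpha => s0; rewrite -[ltLHS]alpha0 Kinfty_lt// ltW.
Qed.

Lemma Kinfty_surj y : 0 <= y -> exists2 s, 0 <= s & alpha s = y.
Proof.
have [cont inc alpha0 lim] := Kalpha => y0.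
have [M [M0 yM]] : exists M, 0 < M /\ y <= alpha M.
  have : \forall s \near +oo, y <= alpha s by move/cvgryPge : lim; exact.
  move=> [M [_ HM]]; exists (Num.max 1 (M + 1)).
  by rewrite lt_max ltr01; split=> //; apply: HM; rewrite lt_max ltrDl ltr01 orbT.
have cM : {within `[0, M], continuous alpha}.
  apply: continuous_subspaceW cont => s /=.
  by rewrite in_itv/= => /andP[].
have [|s] := @IVT R alpha 0 M y (ltW M0) cM.
  by rewrite alpha0 ge_min y0 le_max yM orbT.
by rewrite in_itv/= => /andP[s0 _] <-; exists s.
Qed.

Lemma KinvK y : 0 <= y -> alpha (Kinv alpha y) = y.
Proof.
by move=> /Kinfty_surj[s s0 <-]; apply: pinvK; rewrite inE; exists s.
Qed.

Lemma Kinv_ge0 y : 0 <= y -> 0 <= Kinv alpha y.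
Proof.
have [_ inc _ _] := Kalpha.
move=> /Kinfty_surj[s s0 <-]; rewrite /Kinv pinvKV ?inE// => u t; rewrite !inE/= => u0 t0 st.
by apply/le_anti; rewrite -Kinfty_le// -[t <= u]Kinfty_le// st lexx.
Qed.

(** Turns a strict bound on [V] into a radius strictly inside the ball; a bound by that radius
    survives passage to the limit. *)
Lemma Kinfty_gap c r : 0 < r -> c < alpha r ->
  exists2 s, 0 <= s < r & c <= alpha s.
Proof.
have [_ _ alpha0 _] := Kalpha => r0 cr.
have [c0|c0] := leP 0 c; last by exists 0; rewrite ?lexx// alpha0 ltW.
exists (Kinv alpha c); last by rewrite KinvK.
by rewrite Kinv_ge0// -Kinfty_lt ?KinvK ?Kinv_ge0// ltW.
Qed.

End class_Kinfty.

Section mean_value.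
Context {R : realType} {n : nat}.
Implicit Types (z : R -> 'rV[R]_n) (p q t : R) (d : 'rV[R]_n).

Lemma within_enormB z p q c : {within `[p, q], continuous z} ->
  {within `[p, q], continuous (fun u => enorm (z u - c))}.
Proof.
move=> cz u; apply: (@continuous_comp (subspace `[p, q]) _ _ (fun u => z u - c) (@enorm R n)).
  by apply: cvgB; [exact: cz|exact: cvg_cst].
exact: enorm_continuous.
Qed.

Lemma is_derive1_enorm z t d : is_derive t 1 z d -> forall e, 0 < e ->
  \forall v \near t^'+, enorm (z v - z t) <= (enorm d + e) * (v - t).
Proof.
move=> dz e e0.
have n0 : 0 < (n.+1%:R : R) by rewrite ltr0n.
have := is_derive1_right _ _ _ dz _ (divr_gt0 e0 n0).
move=> H; near=> v.
have tv : 0 < v - t by rewrite subr_gt0; near: v; exact: nbhs_right_gt.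
have Hv : `|z v - z t - (v - t) *: d| <= e / n.+1%:R * (v - t) by near: v.
have := ler_enormD ((v - t) *: d) (z v - z t - (v - t) *: d).
rewrite addrC subrK => /le_trans; apply.
rewrite enormZ gtr0_norm// [leRHS]mulrDl (mulrC (v - t)) lerD2l.
rewrite (le_trans (enorm_le_norm _))//.
apply: (@le_trans _ _ (n.+1%:R * `|z v - z t - (v - t) *: d|)).
  by rewrite ler_wpM2r// ler_nat.
by rewrite mulrC -ler_pdivlMr// mulrAC.
Unshelve. all: by end_near. Qed.

(** The norm need not be differentiable along [z], so the Dini criterion is applied to the
    displacement minus [M * (u - p)]. *)
Lemma enorm_mean_value z (d : R -> 'rV[R]_n) p q M : p <= q ->
  {within `[p, q], continuous z} ->
  (forall t, p < t < q -> is_derive t 1 z (d t)) ->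
  (forall t, p < t < q -> enorm (d t) <= M) ->
  enorm (z q - z p) <= M * (q - p).
Proof.
move=> pq cz dz dM.
suff : enorm (z q - z p) - M * (q - p) <= enorm (z p - z p) - M * (p - p).
  by rewrite !subrr enorm0 mulr0 subrr subr_le0.
apply: (@dini_nonincreasing _ p q (fun u => enorm (z u - z p) - M * (u - p))) => //.
  move=> u; apply: cvgB; first exact: within_enormB.
  apply: cvgMl_tmp; apply: cvgB; last exact: cvg_cst.
  by apply: continuous_subspaceT => {}u; exact: cvg_id.
move=> u upq e e0.
have := is_derive1_enorm _ _ _ (dz u upq) _ e0; have := dM u upq => dMu.
move=> H; near=> v.
have uv : 0 < v - u by rewrite subr_gt0; near: v; exact: nbhs_right_gt.
have Hv : enorm (z v - z u) <= (enorm (d u) + e) * (v - u) by near: v.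
have := ler_enormD (z v - z u) (z u - z p); rewrite subrKA => H2.
have : enorm (d u) * (v - u) <= M * (v - u) by rewrite ler_pM2r.
lra.
Unshelve. all: by end_near. Qed.

End mean_value.

(** The derivative is required only inside, since a segment may start or end at an impulse, where
    only one-sided information exists. *)
Definition flow {R : realType} {n : nat} (f : 'rV[R]_n -> 'rV[R]_n) (p q : R)
    (z : R -> 'rV[R]_n) : Prop :=
  {within `[p, q], continuous z} /\ forall t, p < t < q -> is_derive t 1 z (f (z t)).

Section flow.
Context {R : realType} {n : nat}.
Variable f : 'rV[R]_n -> 'rV[R]_n.
Implicit Types (z : R -> 'rV[R]_n) (p q t : R).

Lemma flow_sub z p q p' q' : p <= p' -> q' <= q -> flow f p q z -> flow f p' q' z.
Proof.
move=> pp qq [cz dz]; split.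
  apply: continuous_subspaceW cz => u /=; rewrite !in_itv/= => /andP[pu uq].
  by rewrite (le_trans pp pu) (le_trans uq qq).
move=> t /andP[pt tq]; apply: dz.
by rewrite (le_lt_trans pp pt) (lt_le_trans tq qq).
Qed.

Lemma eq_flow z w p q : (forall u, p <= u <= q -> z u = w u) ->
  flow f p q z -> flow f p q w.
Proof.
move=> zw [cz dz]; split.
  apply/within_itvP => u upq e e0; have /within_itvP/(_ u upq e e0)[d d0 D] := cz.
  by exists d => // v vpq vu; rewrite -!zw//; exact: D.
move=> t /andP[pt tq]; rewrite -zw ?ltW//.
apply: near_eq_is_derive (dz t _); rewrite ?pt//.
near=> v; apply: zw; apply/andP; split; apply: ltW; near: v.
- exact: lt_nbhsr.
- exact: lt_nbhsl.
Unshelve. all: by end_near. Qed.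

Lemma flow_shift z p q s : flow f p q z -> flow f (p - s) (q - s) (fun u => z (u + s)).
Proof.
move=> [cz dz]; split.
  apply/within_itvP => u upq e e0.
  have upq' : p <= u + s <= q by move: upq; lra.
  have /within_itvP/(_ _ upq' e e0)[d d0 D] := cz.
  exists d => // v vpq vu; apply: D; first by move: vpq; lra.
  by rewrite opprD addrACA subrr addr0.
move=> t tpq; have /dz/is_derive1P D : p < t + s < q by move: tpq; lra.
apply/is_derive1P => e e0; have /nbhs_ballP[d /= d0 {}D] := D e e0.
apply/nbhs_ballP; exists d => //= v vd.
have := D (v + s); rewrite /ball/= opprD addrACA subrr addr0 => /(_ vd).
by rewrite opprD addrACA subrr addr0.
Qed.

(** Gronwall's argument for [enorm (z p) + enorm (z u - z p)]: this dominates [enorm (z u)], equals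
    [enorm (z p)] at the start, and its growth is exactly that of the displacement. *)
Lemma flow_growth z p q L : p <= q -> 0 <= L -> flow f p q z ->
  (forall u, p < u < q -> enorm (f (z u)) <= L * enorm (z u)) ->
  enorm (z q - z p) <= (expR (L * (q - p)) - 1) * enorm (z p).
Proof.
move=> pq L0 [cz dz] fL.
rewrite mulrBl mul1r lerBrDl mulrC.
rewrite -[X in _ <= X * _]addr0 -[in leRHS](@enorm0 R n) -(subrr (z p)).
apply: (@dini_growth _ p q L (fun u => enorm (z p) + enorm (z u - z p))) => //.
- move=> u; apply: cvgD; first exact: cvg_cst.
  exact: within_enormB.
- by move=> u _; rewrite addr_ge0 ?enorm_ge0.
move=> u upq e e0; have H := is_derive1_enorm _ _ _ (dz u upq) _ e0; have fLu := fL u upq.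
near=> v.
have uv : 0 < v - u by rewrite subr_gt0; near: v; exact: nbhs_right_gt.
have Hv : enorm (z v - z u) <= (enorm (f (z u)) + e) * (v - u) by near: v.
have := ler_enormD (z v - z u) (z u - z p); rewrite subrKA => H2.
have H3 : enorm (z u) <= enorm (z p) + enorm (z u - z p) by exact: ler_enorm_dist.
have : enorm (f (z u)) * (v - u) <= L * (enorm (z p) + enorm (z u - z p)) * (v - u).
  by rewrite ler_pM2r// (le_trans fLu)// ler_wpM2l.
lra.
Unshelve. all: by end_near. Qed.

End flow.

Section lyapunov.
Context {R : realType} {n : nat}.
Variables (f : 'rV[R]_n -> 'rV[R]_n) (V : 'rV[R]_n -> R).
Hypothesis hV : class_V V.

Lemma class_V_continuous : continuous V.
Proof.
move=> x; have [_ /(_ x)[U xU [k [_ Vk]]]] := hV.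
apply/(@cvgrPdist_lt _ _ _ _ (nbhs_filter x)) => e e0.
(* The Lipschitz condition holds for every constant above [k]; this one is also positive, so that
   [e / K] makes sense. *)
pose K := Num.max (k + 1) 1.
have K0 : 0 < K by rewrite lt_max ltr01 orbT.
have kK : k < K by rewrite lt_max ltrDl ltr01.
have /nbhs_ballP[d /= d0 dU] := xU.
apply/nbhs_ballP; exists (Num.min d (e / K)) => /=; first by rewrite lt_min d0 divr_gt0.
move=> y; rewrite -ball_normE /ball_/= lt_min => /andP[yd yK].
have Uy : U y by apply: dU; rewrite -ball_normE.
have Ux : U x by exact: nbhs_singleton.
apply: le_lt_trans (Vk K kK (x, y) (conj Ux Uy)) _ => /=.
by rewrite mulrC -ltr_pdivlMr.
Qed.

(* By local Lipschitz continuity, the Dini derivative of [V] along a solution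
   may be computed along the tangent line. *)
Lemma dini_along (z : R -> 'rV[R]_n) (t c : R) :
  is_derive t 1 z (f (z t)) -> (dini f V (z t) <= c%:E)%E ->
  forall e, 0 < e -> \forall v \near t^'+, V (z v) <= V (z t) + (c + e) * (v - t).
Proof.
move=> dz Vc e e0.
have e20 : 0 < e / 2 by rewrite divr_gt0.
have : (dini f V (z t) < (c + e / 2)%:E)%E.
  by rewrite (le_lt_trans Vc)// lte_fin ltrDl.
move=> /ereal_inf_lt[_ [A A0 <-] supA].
have [_ /(_ (z t))[U xU [k [_ Vk]]]] := hV.
pose K := Num.max (k + 1) 1.
have K0 : 0 < K by rewrite lt_max ltr01 orbT.
have kK : k < K by rewrite lt_max ltrDl ltr01.
have H1 := is_derive1_right _ _ _ dz _ (divr_gt0 e20 K0).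
have H2 : \forall v \near t^'+, U (z v).
  by apply: cvg_within; have := is_derive1_continuous _ _ _ dz; exact.
have H3 : \forall v \near t^'+, U (z t + (v - t) *: f (z t)).
  have : (z t + (v - t) *: f (z t)) @[v --> t] --> z t.
    rewrite -[X in _ --> X]addr0 -(scale0r (f (z t))) -[X in X *: _](subrr t).
    apply: cvgD; first exact: cvg_cst.
    by apply: cvgZr_tmp; apply: cvgB; [exact: cvg_id|exact: cvg_cst].
  by move=> /(_ _ xU) ?; exact: cvg_within.
have H4 : \forall v \near t^'+, A (v - t).
  have /at_rightE[d d0 dA] := A0.
  apply/at_rightE; exists d => // v vd; apply: dA; rewrite add0r.
  by rewrite subr_gt0 ltrBlDl.
near=> v.
have tv : 0 < v - t by rewrite subr_gt0; near: v; exact: nbhs_right_gt.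
have H1v : `|z v - z t - (v - t) *: f (z t)| <= e / 2 / K * (v - t) by near: v.
have H2v : U (z v) by near: v.
have H3v : U (z t + (v - t) *: f (z t)) by near: v.
have H4v : A (v - t) by near: v.
have : (((V (z t + (v - t) *: f (z t)) - V (z t)) / (v - t))%:E < (c + e / 2)%:E)%E.
  by apply: le_lt_trans supA; apply: ereal_sup_ubound; exists (v - t).
rewrite lte_fin ltr_pdivrMr// => H5.
have := Vk K kK (_, _) (conj H2v H3v); rewrite /= opprD addrA.
move=> /le_trans/(_ (ler_wpM2l (ltW K0) H1v)).
have -> : K * (e / 2 / K * (v - t)) = e / 2 * (v - t) by field; rewrite gt_eqF.
rewrite ler_norml => /andP[_ H6].
by move: H5 H6; lra.
Unshelve. all: by end_near. Qed.

Variables (mu r : R) (alpha : R -> R).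
Hypotheses (mu0 : 0 <= mu) (r0 : 0 < r) (Kalpha : class_Kinfty alpha).
Hypothesis Valpha : forall x, enorm x < r -> alpha (enorm x) <= V x.
Hypothesis Vdini : forall x, enorm x < r -> (dini f V x <= (mu * V x)%:E)%E.

Lemma within_V (z : R -> 'rV[R]_n) (p q : R) : {within `[p, q], continuous z} ->
  {within `[p, q], continuous (V \o z)}.
Proof.
move=> cz u; apply: (@continuous_comp (subspace `[p, q]) _ _ z V); first exact: cz.
exact: class_V_continuous.
Qed.

Lemma flow_V_growth (z : R -> 'rV[R]_n) (p q : R) : p <= q -> flow f p q z ->
  (forall u, p < u < q -> enorm (z u) < r) ->
  V (z q) <= V (z p) * expR (mu * (q - p)).
Proof.
move=> pq [cz dz] zr; apply: (@dini_growth _ p q mu (V \o z)) => //.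
- exact: within_V.
- by move=> u _ /=; case: hV.
- by move=> u upq e e0; apply: dini_along => //; [exact: dz|exact/Vdini/zr].
Qed.

(* The solution cannot leave the ball: as long as it is inside, [V] stays below
   a level [< alpha r]. *)
Lemma flow_V_ball (z : R -> 'rV[R]_n) (p q : R) : p <= q -> flow f p q z -> enorm (z p) < r ->
  V (z p) * expR (mu * (q - p)) < alpha r ->
  forall u, p <= u <= q -> enorm (z u) < r /\ V (z u) <= V (z p) * expR (mu * (u - p)).
Proof.
move=> pq fz zp Vr.
have [s /andP[s0 sr] Vs] := Kinfty_gap _ Kalpha _ _ r0 Vr.
have V0 x : 0 <= V x by case: hV.
have step u : p <= u <= q -> (forall v, p < v < u -> enorm (z v) < r) ->
    V (z u) <= V (z p) * expR (mu * (u - p)).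
  move=> /andP[pu uq] H; apply: flow_V_growth => //.
  exact: flow_sub fz.
have cn : {within `[p, q], continuous (fun u => enorm (z u))}.
  move=> u; apply: (@continuous_comp (subspace `[p, q]) _ _ z (@enorm R n)); first exact: fz.1.
  exact: enorm_continuous.
have in_ball : forall u, p <= u <= q -> enorm (z u) < r.
  apply: real_induction => //.
    move=> u /andP[pu uq] zu.
    have upq : p <= u <= q by rewrite pu ltW.
    have e0 : 0 < r - enorm (z u) by rewrite subr_gt0.
    have /within_itvP/(_ u upq _ e0)[d d0 D] := cn.
    near=> v.
    have uv : u < v by near: v; exact: nbhs_right_gt.
    have vq : v < q by near: v; exact: nbhs_right_lt.
    have vd : v < u + d by near: v; apply: nbhs_right_lt; rewrite ltrDl.
    have := D v; rewrite (ltW (le_lt_trans pu uv)) (ltW vq) => /(_ isT).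
    rewrite gtr0_norm ?subr_gt0// ltrBlDl => /(_ vd).
    by rewrite ltr_norml ltrD2r => /andP[].
  move=> u /andP[pu uq] H; apply: le_lt_trans sr.
  have Hs v : p <= v < u -> enorm (z v) <= s.
    move=> /andP[pv vu].
    have vr : enorm (z v) < r by apply: H; rewrite pv.
    rewrite -(Kinfty_le _ Kalpha) ?enorm_ge0// (le_trans _ Vs)//.
    rewrite (le_trans (Valpha _ vr))//.
    apply: le_trans (step v _ _) _.
    - by rewrite pv (le_trans (ltW vu)).
    - by move=> w /andP[pw wv]; apply: H; rewrite (ltW pw) (lt_trans wv).
    by rewrite ler_wpM2l// ler_expR ler_wpM2l// lerD2r (le_trans (ltW vu)).
  apply/ler_addgt0Pr => e e0.
  have upq : p <= u <= q by rewrite uq ltW.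
  have /within_itvP/(_ u upq _ e0)[d d0 D] := cn.
  pose v := Num.max p (u - d / 2).
  have pv : p <= v by rewrite le_max lexx.
  have vu : v < u by rewrite gt_max pu gtrBl divr_gt0.
  have dv : u - d / 2 <= v by rewrite le_max lexx orbT.
  have := D v; rewrite pv (le_trans (ltW vu) uq) => /(_ isT).
  rewrite ltr0_norm ?subr_lt0// => /(_ ltac:(lra)).
  rewrite ltr_norml => /andP[D1 _].
  by have := Hs v; rewrite pv vu => /(_ isT); lra.
move=> u /andP[pu uq]; split; first by rewrite in_ball// pu.
apply: step; first by rewrite pu.
by move=> v /andP[pv vu]; apply: in_ball; rewrite (ltW pv) (ltW (lt_le_trans vu uq)).
Unshelve. all: by end_near. Qed.

End lyapunov.

(** * Peano's existence theorem *)

Lemma fmap_ultra {T U : Type} (h : T -> U) (F : set_system T) :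
  UltraFilter F -> UltraFilter (h @ F).
Proof.
move=> FU; split; first exact: fmap_proper_filter.
move=> G GP hFG; apply/seteqP; split=> // A GA.
have [//|nA] := in_ultra_setVsetC (h @^-1` A) FU.
have : G (~` A) by apply: hFG.
by move=> /(filterI GA); rewrite setICr => /filter_not_empty.
Qed.

Section peano.
Context {R : realType} {n : nat}.
Variables (f : 'rV[R]_n -> 'rV[R]_n) (y0 : 'rV[R]_n).

Fixpoint euler (h : R) (i : nat) : 'rV[R]_n :=
  if i is j.+1 then euler h j + h *: f (euler h j) else y0.

(** The free slope [c] serves twice: [c = 0] gives the Lipschitz bound, and [c] the value of [f] at
    the limit point gives the secant estimate. *)
Lemma euler_near h i m c e : 0 <= h ->
  (forall k, (i <= k < i + m)%N -> `|f (euler h k) - c| <= e) ->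
  `|euler h (i + m) - euler h i - (m%:R * h) *: c| <= m%:R * h * e.
Proof.
move=> h0; elim: m => [|m IH] H.
  by rewrite addn0 subrr mul0r scale0r subr0 normr0 mul0r.
rewrite addnS /=.
have -> : euler h (i + m) + h *: f (euler h (i + m)) - euler h i - (m.+1%:R * h) *: c =
  (euler h (i + m) - euler h i - (m%:R * h) *: c) + h *: (f (euler h (i + m)) - c).
  rewrite -natr1 mulrDl mul1r scalerDl scalerBr opprD !addrA.
  by congr (_ - _); rewrite -!addrA; congr (_ + _); rewrite addrC -!addrA.
rewrite -natr1 mulrDl mul1r mulrDl (le_trans (ler_normD _ _))// lerD//.
  by apply: IH => k /andP[ik km]; apply: H; rewrite ik addnS ltnS ltnW.
by rewrite normrZ ger0_norm// ler_wpM2l// H// leq_addr addnS ltnS leqnn.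
Qed.

Variables (rad M : R).
Hypotheses (rad0 : 0 < rad) (M0 : 0 < M).
Hypothesis fM : forall q, `|q - y0| <= rad -> `|f q| <= M.

Lemma euler_bound h i : 0 <= h -> i%:R * h * M <= rad -> `|euler h i - y0| <= i%:R * h * M.
Proof.
move=> h0; elim: i => [|i IH] ir; first by rewrite subrr normr0 !mul0r.
have iS : i%:R * h * M <= i.+1%:R * h * M.
  by rewrite ler_wpM2r ?(ltW M0)// ler_wpM2r// ler_nat.
have {}IH := IH (le_trans iS ir).
rewrite /= addrAC (le_trans (ler_normD _ _))// -natr1 !mulrDl mul1r lerD//.
by rewrite normrZ ger0_norm// ler_wpM2l// fM// (le_trans IH)// (le_trans iS).
Qed.

Lemma euler_lipschitz h i m : 0 <= h -> (i + m)%:R * h * M <= rad ->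
  `|euler h (i + m) - euler h i| <= m%:R * h * M.
Proof.
move=> h0 imr; rewrite -[X in `|X|]subr0 -(scaler0 _ (m%:R * h)).
apply: euler_near => // k /andP[_ km]; rewrite subr0 fM//.
have kr : k%:R * h * M <= rad.
  by rewrite (le_trans _ imr)// ler_wpM2r ?(ltW M0)// ler_wpM2r// ler_nat ltnW.
by rewrite (le_trans (euler_bound _ _ h0 kr)).
Qed.

(** Piecewise constant instead of the usual polygon: every value is an Euler node, and the jumps, of
    order [h], disappear in the limit. *)
Definition euler_step (h t : R) := euler h (Num.truncn (t / h)).

Lemma truncn_step (h t : R) : 0 < h -> 0 <= t ->
  (Num.truncn (t / h))%:R * h <= t < (Num.truncn (t / h))%:R * h + h.
Proof.
move=> h0 t0; have /truncn_itv/andP[] : 0 <= t / h by rewrite divr_ge0// ltW.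
by rewrite ler_pdivlMr// ltr_pdivrMr// -natr1 mulrDl mul1r => -> ->.
Qed.

Lemma truncn_steps (h s t : R) : 0 < h -> 0 <= s <= t -> exists m,
  [/\ Num.truncn (t / h) = (Num.truncn (s / h) + m)%N,
     m%:R * h < t - s + h & t - s - h < m%:R * h].
Proof.
move=> h0 /andP[s0 st].
have /andP[s1 s2] := truncn_step _ _ h0 s0.
have /andP[t1 t2] := truncn_step _ _ h0 (le_trans s0 st).
have ij : (Num.truncn (s / h) <= Num.truncn (t / h))%N.
  rewrite -ltnS -(ltr_nat R) -(ltr_pM2r h0) -natr1 (mulrDl _ 1) mul1r.
  by rewrite (le_lt_trans s1)// (le_lt_trans st).
exists (Num.truncn (t / h) - Num.truncn (s / h))%N.
by rewrite subnKC// natrB// mulrBl; split=> //; lra.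
Qed.

Lemma euler_step_bound h t : 0 < h -> 0 <= t -> t * M <= rad ->
  `|euler_step h t - y0| <= t * M.
Proof.
move=> h0 t0 tr; have /andP[t1 _] := truncn_step _ _ h0 t0.
have t1' : (Num.truncn (t / h))%:R * h * M <= t * M by rewrite ler_pM2r.
by rewrite (le_trans (euler_bound _ _ (ltW h0) (le_trans t1' tr))).
Qed.

(** The anchor [a] may be either end, because a derivative is later tested on both sides of a point.
    The last hypothesis keeps all nodes between [s] and [t] within [d] of the anchor; the term in
    [h] times the norm of [c] comes from rounding the number of steps. *)
Lemma euler_step_secant h s t a c e d : 0 < h -> 0 <= s <= t -> t * M <= rad ->
  (a = s \/ a = t) -> 0 <= e ->
  (forall q, `|q - euler_step h a| < d -> `|f q - c| <= e) ->
  (t - s + h) * M < d ->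
  `|euler_step h t - euler_step h s - (t - s) *: c| <= (t - s + h) * e + h * `|c|.
Proof.
move=> h0 st tr ast e0 fc dM.
have [m [tE m1 m2]] := truncn_steps _ _ _ h0 st.
have /andP[s0 ts] := st.
have /andP[t1 _] := truncn_step _ _ h0 (le_trans s0 ts).
set i := Num.truncn (s / h) in tE.
have lip k l : (k + l <= i + m)%N -> (l <= m)%N -> `|euler h (k + l) - euler h k| < d.
  move=> kl lm; apply: le_lt_trans (euler_lipschitz h k l (ltW h0) _) _.
    rewrite (le_trans _ tr)// ler_pM2r// (le_trans _ t1)// tE ler_pM2r// ler_nat//.
  apply: le_lt_trans dM; rewrite ler_pM2r// ltW// (le_lt_trans _ m1)//.
  by rewrite ler_pM2r// ler_nat.
have := euler_near h i m c e (ltW h0).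
rewrite /euler_step tE -/i => H.
have -> : euler h (i + m) - euler h i - (t - s) *: c =
  (euler h (i + m) - euler h i - (m%:R * h) *: c) + (m%:R * h - (t - s)) *: c.
  by rewrite [in RHS]scalerBl addrA subrK.
rewrite (le_trans (ler_normD _ _))// lerD//.
  apply: le_trans (H _) _; last by rewrite ler_wpM2r// ltW.
  move=> k /andP[ik km]; apply: fc.
  have aE : euler_step h a = euler h i \/ euler_step h a = euler h (i + m).
    by case: ast => ->; [left|right; rewrite -tE].
  case: aE => ->.
    have -> : k = (i + (k - i))%N by rewrite subnKC.
    by apply: lip; [rewrite subnKC// ltnW|rewrite leq_subLR ltnW].
  rewrite distrC.
  have -> : (i + m = k + (i + m - k))%N by rewrite subnKC// ltnW.
  by apply: lip; [rewrite subnKC// ltnW|rewrite leq_subLR leq_add2r].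
by rewrite normrZ ler_wpM2r// ler_norml; apply/andP; split; lra.
Qed.

End peano.

(* The Euler step functions converge pointwise along an ultrafilter, by
   compactness; no equicontinuity argument is needed because the secant estimate
   [euler_step_secant] survives the pointwise limit. *)
Lemma peano {R : realType} {n : nat} (f : 'rV[R]_n -> 'rV[R]_n) (y0 : 'rV[R]_n) :
  continuous f -> exists2 eta : R, 0 < eta & exists z : R -> 'rV[R]_n,
  [/\ z 0 = y0, z u @[u --> 0^'+] --> y0 &
     forall t : R, 0 < t < eta -> is_derive t 1 z (f (z t))].
Proof.
move=> cf.
pose M := `|f y0| + 1.
have M0 : 0 < M by rewrite ltr_wpDl.
have [rad rad0 fM] : exists2 rad, 0 < rad & forall q, `|q - y0| <= rad -> `|f q| <= M.
  have /(@cvgrPdist_lt _ _ _ _ (nbhs_filter y0))/(_ 1 ltr01)/nbhs_ballP[d /= d0 D] := cf y0.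
  exists (d / 2); first by rewrite divr_gt0.
  move=> q qy; have : `|f y0 - f q| < 1.
    by apply: D; rewrite -ball_normE /ball_/= distrC; lra.
  have := ler_normB (f y0) (f y0 - f q); rewrite opprB addrC subrK => H1 H2.
  by rewrite /M (le_trans H1)// lerD2l ltW.
(* Before this time, a motion of speed at most [M] cannot leave the ball of radius [rad] around
   [y0]. *)
pose eta := rad / M.
have etaM t : t < eta -> t * M <= rad by move=> te; rewrite -ler_pdivlMr// ltW.
(* One ultrafilter serves all times [t] at once, in place of a diagonal extraction of
   subsequences. *)
have [U [UU oU]] := ultraFilterLemma (@eventually_filter).
pose hN : nat -> R := harmonic.
have hN0 N : 0 < hN N by rewrite /hN /harmonic invr_gt0 ltr0n.
have hNcvg : hN @ U --> (0 : R).
  by apply: cvg_trans cvg_harmonic; exact: cvg_app.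
pose Z N t := euler_step f y0 (hN N) t.
have cvgZ t : 0 <= t < eta -> cvg (Z N t @[N --> U]).
  move=> /andP[t0 /etaM te].
  have cA := @rV_compact _ n (fun i => `[y0 ord0 i - rad, y0 ord0 i + rad]%classic)
    (fun i => @segment_compact R _ _).
  rewrite compact_ultra in cA.
  have [|l [_ lE]] := cA (Z^~ t @ U) (fmap_ultra _ _ UU); last by apply/cvg_ex; exists l.
  apply: (@filterE _ U _ ((Z^~ t) @^-1` _)) => N i /=; rewrite in_itv/=.
  have := euler_step_bound f y0 _ _ M0 fM (hN N) t (hN0 N) t0 te.
  move=> /le_trans/(_ te) /(le_trans (coord_le_norm _ i)).
  by rewrite !mxE ler_norml => /andP[H1 H2]; apply/andP; split; lra.
pose z t := lim (Z N t @[N --> U]).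
have Zz t : 0 <= t < eta -> Z N t @[N --> U] --> z t by exact: cvgZ.
have eta0 : 0 < eta by rewrite divr_gt0.
have z0 : z 0 = y0.
  apply: cvg_lim => //; apply: cvg_near_cst; apply: filterE => N.
  by rewrite /Z /euler_step mul0r truncn0.
exists eta => //; exists z; split=> //.
  have zM t : 0 < t < eta -> `|z t - y0| <= t * M.
    move=> /andP[t0 te].
    have c1 : `|Z N t - y0| @[N --> U] --> `|z t - y0|.
      by apply: cvg_norm; apply: cvgB; [apply: Zz; rewrite ltW|exact: cvg_cst].
    apply: (ler_cvg_to c1 (cvg_cst (t * M))).
    apply: filterE => N; apply: (euler_step_bound f y0 rad M M0 fM) => //.
      exact: ltW.
    exact: etaM.
  apply/cvgrPdist_le => e e0; near=> t.
  have t0 : 0 < t by near: t; exact: nbhs_right_gt.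
  have te : t < eta by near: t; exact: nbhs_right_lt.
  have tM : t < e / M by near: t; apply: nbhs_right_lt; rewrite divr_gt0.
  rewrite distrC (le_trans (zM t _)) ?t0//.
  by rewrite -ler_pdivlMr// ltW.
move=> t /andP[t0 te]; apply/is_derive1P => e e0.
have e20 : 0 < e / 2 by rewrite divr_gt0.
have /(@cvgrPdist_lt _ _ _ _ (nbhs_filter (z t)))/(_ _ e20)/nbhs_ballP[d /= d0 D] := cf (z t).
have d20 : 0 < d / 2 by rewrite divr_gt0.
(* Half of [d] covers the motion of the Euler values over the interval, the other half their
   distance to the limit at [t]. *)
have key a s s' : 0 <= s <= s' -> s' < eta -> (a = s \/ a = s') -> a = t ->
    (s' - s) * M < d / 2 ->
    `|z s' - z s - (s' - s) *: f (z t)| <= (s' - s) * (e / 2).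
  move=> ss' s'e ass at_ sd.
  have /andP[s0 ss] := ss'.
  have c1 : `|Z N s' - Z N s - (s' - s) *: f (z t)| @[N --> U] -->
      `|z s' - z s - (s' - s) *: f (z t)|.
    apply: cvg_norm; apply: cvgB; last exact: cvg_cst.
    by apply: cvgB; apply: Zz; rewrite ?(le_trans s0 ss)// s0 (le_lt_trans ss).
  have c2 : (s' - s + hN N) * (e / 2) + hN N * `|f (z t)| @[N --> U] -->
      (s' - s) * (e / 2).
    have -> : (s' - s) * (e / 2) = (s' - s + 0) * (e / 2) + 0 * `|f (z t)|.
      by rewrite mul0r !addr0.
    apply: cvgD; first by apply: cvgMr_tmp; apply: cvgD; [exact: cvg_cst|exact: hNcvg].
    by apply: cvgMr_tmp; exact: hNcvg.
  apply: (ler_cvg_to c1 c2).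
  have n1 : \forall N \near U, hN N * M < d / 2 - (s' - s) * M.
    have h1 : 0 < (d / 2 - (s' - s) * M) / M by rewrite divr_gt0// subr_gt0.
    near=> N; rewrite -ltr_pdivlMr//; near: N.
    by apply: (cvgr_lt (0 : R)); first exact: hNcvg.
  have n2 : \forall N \near U, `|z t - Z N t| < d / 2.
    have := Zz t; rewrite te ltW// => /(_ isT) H.
    by have /cvgrPdist_lt/(_ _ d20) := H.
  near=> N.
  have N1 : hN N * M < d / 2 - (s' - s) * M by near: N.
  have N2 : `|z t - Z N t| < d / 2 by near: N.
  apply: (euler_step_secant f y0 rad M M0 fM _ _ _ a _ _ (d / 2)) => //.
  - exact: etaM.
  - exact: ltW.
  - move=> q qa; rewrite distrC ltW//; apply: D.
    rewrite -ball_normE /ball_/= -(subrKA (Z N t)).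
    rewrite (le_lt_trans (ler_normD _ _))// [ltRHS]splitr ltrD//.
    by rewrite distrC /Z -at_.
  - by lra.
have H : \forall v \near t, [/\ 0 < v, v < eta & `|v - t| < d / 2 / M].
  near=> v; split; near: v.
  - exact: lt_nbhsr.
  - exact: lt_nbhsl.
  - apply: cvgr_distC_lt; first exact: cvg_id.
    by rewrite divr_gt0.
near=> v.
have [v0 ve vt] : [/\ 0 < v, v < eta & `|v - t| < d / 2 / M] by near: v.
have le2 x : 0 <= x -> x * (e / 2) <= e * x.
  by move=> x0; rewrite mulrC ler_wpM2r// ler_pdivrMr// ler_peMr ?ler1n// ltW.
have [tv|vt'] := leP t v.
  move: vt; rewrite ger0_norm ?subr_ge0// ltr_pdivlMr// => vt.
  apply: le_trans (key t t v _ ve (or_introl erefl) erefl vt) _.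
    by rewrite tv ltW.
  by rewrite le2// subr_ge0.
move: vt; rewrite distrC gtr0_norm ?subr_gt0// ltr_pdivlMr// => vt.
have := key t v t _ te (or_intror erefl) erefl vt.
rewrite (ltW v0) (ltW vt') => /(_ isT) K.
have -> : z v - z t - (v - t) *: f (z t) = - (z t - z v - (t - v) *: f (z t)).
  by rewrite -(opprB t v) scaleNr opprK opprD opprB opprK.
rewrite normrN.
by rewrite (le_trans K)// le2// subr_ge0 ltW.
Unshelve. all: by end_near. Qed.

(** * One-sided limits of solutions *)

Section flow_limits.
Context {R : realType} {n : nat}.
Variable f : 'rV[R]_n -> 'rV[R]_n.
Implicit Types (z : R -> 'rV[R]_n) (p q t : R) (l : 'rV[R]_n).

(** Closes a segment at an impulse time [q], where [z q] is already the state after the jump. *)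
Lemma flow_left_limit z p q l : p < q -> z u @[u --> p^'+] --> z p ->
  (forall t, p < t < q -> is_derive t 1 z (f (z t))) ->
  z u @[u --> q^'-] --> l -> flow f p q (fun u => if u < q then z u else l).
Proof.
move=> pq zp dz zq; split.
  apply/continuous_within_itvP => //; split.
  - move=> t; rewrite in_itv/= => /andP[pt tq].
    have ct := is_derive1_continuous _ _ _ (dz t _).
    rewrite /continuous_at tq; apply: cvg_trans (ct _); last by rewrite pt.
    apply: near_eq_cvg; near=> u.
    suff -> : u < q by [].
    by near: u; exact: lt_nbhsl.
  - rewrite pq; apply: cvg_trans zp; apply: near_eq_cvg; near=> u.
    suff -> : u < q by [].
    by near: u; exact: nbhs_right_lt.
  - rewrite ltxx; apply: cvg_trans zq; apply: near_eq_cvg; near=> u.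
    suff -> : u < q by [].
    by near: u; exact: nbhs_left_lt.
move=> t /andP[pt tq]; rewrite tq; apply: near_eq_is_derive (dz t _); last by rewrite pt.
near=> u; suff -> : u < q by [].
by near: u; exact: lt_nbhsl.
Unshelve. all: by end_near. Qed.

Lemma flow_closed z p q : p < q -> z u @[u --> p^'+] --> z p ->
  (forall t, p < t <= q -> is_derive t 1 z (f (z t))) -> flow f p q z.
Proof.
move=> pq zp dz.
have zq : z u @[u --> q^'-] --> z q.
  apply: cvg_at_left_filter; apply: is_derive1_continuous (dz q _).
  by rewrite pq lexx.
apply: eq_flow (flow_left_limit z p q (z q) pq zp _ zq).
  by move=> u /andP[_]; rewrite le_eqVlt => /orP[/eqP ->|->//]; rewrite ltxx.
by move=> t /andP[pt tq]; apply: dz; rewrite pt ltW.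
Qed.

Lemma bounded_left_limit z p q M : p < q ->
  (forall t, p < t < q -> is_derive t 1 z (f (z t)) /\ enorm (f (z t)) <= M) ->
  cvg (z u @[u --> q^'-]).
Proof.
move=> pq dz; apply/cauchy_cvgP/cauchy_exP => e e0.
have M0 : 0 <= M.
  have [|_] := dz ((p + q) / 2); first by apply/andP; split; lra.
  exact: le_trans (enorm_ge0 _).
pose M1 := M + 1.
have M10 : 0 < M1 by rewrite ltr_wpDl.
pose u := Num.max ((p + q) / 2) (q - e / M1 / 2).
have eM : 0 < e / M1 by rewrite divr_gt0.
have pu : p < u by rewrite lt_max; apply/orP; left; lra.
have uq : u < q by rewrite gt_max; apply/andP; split; lra.
have ue : q - e / M1 / 2 <= u by rewrite le_max lexx orbT.
exists (z u); suff : \forall v \near q^'-, ball (z u) e (z v) by [].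
near=> v.
have uv : u < v by near: v; exact: nbhs_left_gt.
have vq : v < q by near: v; exact: nbhs_left_lt.
rewrite -ball_normE /ball_/= distrC (le_lt_trans (norm_le_enorm _))//.
have dv t : u <= t <= v -> is_derive t 1 z (f (z t)) /\ enorm (f (z t)) <= M.
  by move=> /andP[ut tv]; apply: dz; rewrite (lt_le_trans pu)// (le_lt_trans tv).
have := enorm_mean_value z (fun t => f (z t)) u v M (ltW uv).
have fz : flow f u v z.
  apply: flow_closed => //.
    apply: cvg_at_right_filter; apply: is_derive1_continuous (dv u _).1.
    by rewrite lexx ltW.
  by move=> t /andP[ut tv]; apply: (dv t _).1; rewrite ltW.
move=> /(_ fz.1 fz.2) H; apply: le_lt_trans (H _) _.
  by move=> t /andP[ut tv]; apply: (dv t _).2; rewrite !ltW.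
apply: (@le_lt_trans _ _ (M1 * (v - u))).
  by rewrite ler_wpM2r ?subr_ge0 ?(ltW uv)// lerDl.
by rewrite mulrC -ltr_pdivlMr//; lra.
Unshelve. all: by end_near. Qed.

Lemma is_derive1_tangent z c t d : is_derive t 1 z d ->
  is_derive t 1 (fun u => z u - u *: c) (d - c).
Proof.
move=> /is_derive1P H; apply/is_derive1P => e e0; apply: filterS (H e e0) => v.
suff -> : z v - v *: c - (z t - t *: c) - (v - t) *: (d - c) =
  z v - z t - (v - t) *: d by [].
by apply/rowP => i; rewrite !mxE; ring.
Qed.

Lemma flow_tangent z p q c e : p <= q -> flow f p q z ->
  (forall t, p < t < q -> enorm (f (z t) - c) <= e) ->
  enorm (z q - z p - (q - p) *: c) <= e * (q - p).
Proof.
move=> pq [cz dz] fe.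
have := enorm_mean_value (fun u => z u - u *: c) (fun t => f (z t) - c) p q e pq.
have -> : z q - q *: c - (z p - p *: c) = z q - z p - (q - p) *: c.
  by apply/rowP => i; rewrite !mxE; ring.
apply => //.
  move=> u; apply: cvgB; first exact: cz.
  apply: cvgZr_tmp; apply: continuous_subspaceT => {}u; exact: cvg_id.
by move=> t tpq; apply: is_derive1_tangent; exact: dz.
Qed.

(** By continuity of [f], the velocity near [t] is within [e] of [f (z t)] on both sides;
    [flow_tangent] then bounds the deviation from the tangent on each side, which is
    differentiability at the junction. *)
Lemma flow_glue z p t q : continuous f -> p < t -> t < q ->
  flow f p t z -> flow f t q z -> is_derive t 1 z (f (z t)).
Proof.
move=> cf pt tq fl fr; apply/is_derive1P => e e0.
have cn : (fun y => enorm (f y - f (z t))) y @[y --> z t] --> (0 : R).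
  rewrite -(@enorm0 R n) -(subrr (f (z t))).
  apply: (cvg_comp (fun y => f y - f (z t)) (@enorm R n)); last exact: enorm_continuous.
  by apply: (@cvgB _ _ _ _ (nbhs_filter (z t))); [exact: cf|exact: cvg_cst].
have [D zD Df] : exists2 D, 0 < D & forall y, `|y - z t| < D -> enorm (f y - f (z t)) <= e.
  have /cvgrPdist_lt/(_ _ e0)/nbhs_ballP[D /= D0 H] := cn.
  exists D => // y yD; have : ball (z t) D y by rewrite -ball_normE /ball_/= distrC.
  by move=> /H; rewrite sub0r normrN ger0_norm ?enorm_ge0// => /ltW.
have tl : p <= t <= t by rewrite lexx ltW.
have tr : t <= t <= q by rewrite lexx ltW.
have /within_itvP/(_ t tl _ zD)[d1 d10 D1] := fl.1.
have /within_itvP/(_ t tr _ zD)[d2 d20 D2] := fr.1.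
near=> v.
have pv : p < v by near: v; exact: lt_nbhsr.
have vq : v < q by near: v; exact: lt_nbhsl.
have v1 : `|v - t| < d1 by near: v; apply: cvgr_distC_lt => //; exact: cvg_id.
have v2 : `|v - t| < d2 by near: v; apply: cvgr_distC_lt => //; exact: cvg_id.
apply: le_trans (norm_le_enorm _) _.
have [tv|vt] := lerP t v.
  apply: flow_tangent => //; first exact: flow_sub (lexx _) (ltW vq) fr.
  move=> u /andP[tu uv]; apply: Df; apply: D2.
    by rewrite !ltW//; exact: lt_trans vq.
  rewrite gtr0_norm ?subr_gt0//; apply: le_lt_trans v2.
  by rewrite ger0_norm ?subr_ge0// lerD2r ltW.
have -> : z v - z t - (v - t) *: f (z t) = - (z t - z v - (t - v) *: f (z t)).
  by rewrite -(opprB t v) scaleNr opprK opprD opprB opprK.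
rewrite enormN; apply: flow_tangent => //; first exact: ltW.
  exact: flow_sub (ltW pv) (lexx _) fl.
move=> u /andP[vu ut]; apply: Df; apply: D1.
  by rewrite !ltW//; exact: lt_trans vu.
rewrite ltr0_norm ?subr_lt0// opprB; apply: le_lt_trans v1.
by rewrite ltr0_norm ?subr_lt0// opprB lerD2l lerN2 ltW.
Unshelve. all: by end_near. Qed.

End flow_limits.

(** * Event times *)

(** The trapezoidal rule overestimates the integral of the convex function [expR]. The difference
    [k] has derivative [1 + (v - 1) * expR v], nonnegative by [1 - v <= expR (- v)]. *)
Lemma expR_trapezoid {R : realType} (u : R) : 0 <= u ->
  2 * (expR u - 1) <= u * (expR u + 1).
Proof.
rewrite le_eqVlt => /orP[/eqP<-|u0]; first by rewrite expR0 subrr mulr0 mul0r.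
pose k (v : R) := v * (expR v + 1) - 2 * (expR v - 1).
have dk (v : R) : is_derive v 1 k (1 + (v - 1) * expR v).
  apply: is_derive_eq; rewrite /= !scaler1 ?/GRing.scale/=; ring.
have ck : {within `[0, u], continuous k}.
  by apply: continuous_subspaceT => v; apply: is_derive1_continuous (dk v).
have [c] := MVT u0 (fun v _ => dk v) ck.
rewrite in_itv/= => /andP[c0 cu]; rewrite subr0 {1 2}/k expR0 mul0r !subrr mulr0 !subr0 => kE.
rewrite -subr_ge0 kE mulr_ge0 ?(ltW u0)//.
have := expR_ge1Dx (- c).
rewrite expRN -(ler_pM2r (expR_gt0 c)) mulVf ?gt_eqF ?expR_gt0//.
by lra.
Qed.

(* Replaces the Cauchy-Schwarz step that produces the square root in [hL]. *)
Lemma expR_sub1_le_sqrt {R : realType} (u : R) : 0 <= u ->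
  expR u - 1 <= Num.sqrt (u * (expR (2 * u) - 1) / 2).
Proof.
move=> u0; have e1 : 0 <= expR u - 1 by rewrite subr_ge0 -expR0 ler_expR.
rewrite -[leLHS]ger0_norm// -sqrtr_sqr ler_wsqrtr//.
have -> : 2 * u = u + u by ring.
rewrite expRD; have := ler_wpM2l e1 (expR_trapezoid _ u0).
by rewrite ler_pdivlMr//; lra.
Qed.

Section events.
Context {R : realType} {n : nat}.
Variables (V : 'rV[R]_n -> R) (a b delta tau : R).
Implicit Types (x y : R -> 'rV[R]_n) (T lo : \bar R).

Definition threshold (t : R) := a * expR (- (b * t)).

(* The state that [next_event] compares with the threshold at time [t]. *)
Definition event_state x lo (t : R) :=
  if (lo < t%:E)%E then prejump tau x t else x t.

Local Notation next := (next_event V a b delta tau).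
Local Notation event := (event_time V a b delta tau).

Lemma next_event_le x T lo j : (0 < j)%N -> (lo <= (j%:R * delta)%:E < T)%E ->
  threshold (j%:R * delta) <= V (event_state x lo (j%:R * delta)) ->
  (next x T lo <= (j%:R * delta)%:E)%E.
Proof. by move=> j0 jT jV; apply: ereal_inf_lbound; exists j. Qed.

Lemma next_event_ge x T lo : (lo <= next x T lo)%E.
Proof. by apply: le_ereal_inf_tmp => _ [j [_ /andP[+ _] _] <-]. Qed.

Lemma next_event_gt0 x T lo : 0 < delta -> (0 < next x T lo)%E.
Proof.
move=> d0; apply: (@lt_le_trans _ _ delta%:E); first by rewrite lte_fin.
apply: le_ereal_inf_tmp => _ [j [j0 _ _] <-].
by rewrite lee_fin ler_peMl ?(ltW d0)// ler1n.
Qed.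

(** Sampling times are discrete, so a finite infimum is attained, at the least admissible index. *)
Lemma next_event_finite x T lo s : 0 < delta -> next x T lo = s%:E ->
  exists j, [/\ (0 < j)%N, s = j%:R * delta, (lo <= s%:E < T)%E &
    threshold s <= V (event_state x lo s)].
Proof.
move=> d0 nE.
pose P (j : nat) := [&& (0 < j)%N, (lo <= (j%:R * delta)%:E)%E, ((j%:R * delta)%:E < T)%E &
  threshold (j%:R * delta) <= V (event_state x lo (j%:R * delta))].
have [exP|nP] := pselect (exists j, P j); last first.
  exfalso; move: nE; rewrite /next_event (_ : [set _ | _ in _] = set0) ?ereal_inf0//.
  rewrite -subset0 => t [j [j0 /andP[j1 j2] j3] _]; apply: nP; exists j.
  by rewrite /P j0 j1 j2.
case: (ex_minnP exP) => j /and4P[j0 j1 j2 j3] jmin.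
exists j; suff -> : s = j%:R * delta by rewrite j1 j2.
apply/EFin_inj; rewrite -nE; apply/le_anti/andP; split.
  by apply: next_event_le; rewrite ?j1.
apply: le_ereal_inf_tmp => _ [i [i0 /andP[i1 i2] i3] <-].
rewrite lee_fin ler_pM2r// ler_nat; apply: jmin.
by rewrite /P i0 i1 i2.
Qed.

Lemma lt_next_event x T lo j : (0 < j)%N -> (lo <= (j%:R * delta)%:E < T)%E ->
  ((j%:R * delta)%:E < next x T lo)%E ->
  V (event_state x lo (j%:R * delta)) < threshold (j%:R * delta).
Proof. by move=> j0 jT; apply: contraTT; rewrite -!leNgt; exact: next_event_le. Qed.

(** Since [event x T k] is the event numbered [k + 1], this is the impulse time of event number [k],
    or 0 at the beginning: the start of a segment of the trajectory. *)
Definition event_start x T k : \bar R :=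
  if k is k'.+1 then (event x T k' + tau%:E)%E else 0%E.

Lemma event_timeE x T k : event x T k = next x T (event_start x T k).
Proof. by case: k. Qed.

Lemma event_start_le x T k : (event_start x T k <= event x T k)%E.
Proof. by rewrite event_timeE; exact: next_event_ge. Qed.

Hypotheses (delta0 : 0 < delta) (tau0 : 0 <= tau).

Lemma event_gt0 x T k : (0 < event x T k)%E.
Proof. by rewrite event_timeE next_event_gt0. Qed.

Lemma event_start_ge0 x T k : (0 <= event_start x T k)%E.
Proof. by case: k => [//|k]; rewrite adde_ge0 ?lee_fin// ltW// event_gt0. Qed.

Lemma event_start_nd x T : {homo event_start x T : k l / (k <= l)%N >-> (k <= l)%E}.
Proof.
apply: homo_leq => //; first exact: le_trans.
by move=> k; apply: le_trans (event_start_le _ _ _) _; rewrite /= leeDl// lee_fin.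
Qed.

Lemma event_finite x T k s : event x T k = s%:E ->
  exists p, event_start x T k = p%:E /\ 0 <= p <= s.
Proof.
move=> kE; have := event_start_le x T k; have := event_start_ge0 x T k.
rewrite kE; case: (event_start x T k) => [p| |]//.
by rewrite !lee_fin => p0 ps; exists p; rewrite p0.
Qed.

Lemma event_start_finite x T k p : event_start x T k.+1 = p%:E ->
  exists s, event x T k = s%:E /\ p = s + tau.
Proof.
rewrite /=; case: (event x T k) => [s| |]//=.
by case=> <-; exists s.
Qed.

(** With [tau = 0] only a left limit is read, so agreement before [S] is enough even at [t = S]. *)
Lemma eq_prejump x y (S t : R) : (forall u, 0 <= u < S -> x u = y u) ->
  0 < t -> t < S \/ tau = 0 /\ t <= S -> prejump tau x t = prejump tau y t.
Proof.
move=> xy t0 tS; rewrite /prejump; case: eqP => [t00|tau0']; last first.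
  by apply: xy; rewrite (ltW t0)/=; case: tS => [//|[]].
have tS' : t <= S by case: tS => [/ltW|[]].
have xyt : \forall u \near t^'-, x u = y u.
  near=> u; apply: xy; apply/andP; split.
    by apply: ltW; near: u; exact: nbhs_left_gt.
  by rewrite (lt_le_trans _ tS')//; near: u; exact: nbhs_left_lt.
congr (lim _); apply/seteqP; split; apply: near_eq_cvg => //.
by near do apply/esym.
Unshelve. all: by end_near. Qed.

Lemma eq_event_state x y (S t : R) lo : (forall u, 0 <= u < S -> x u = y u) ->
  0 < t -> t < S \/ [/\ tau = 0, (lo < t%:E)%E & t <= S] ->
  event_state x lo t = event_state y lo t.
Proof.
move=> xy t0 tS; rewrite /event_state; case: ifPn => lot.
  by apply: (eq_prejump _ _ S) => //; case: tS => [|[]]; [left|right].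
case: tS => [tS|[_]]; last by rewrite (negPf lot).
by apply: xy; rewrite tS (ltW t0).
Qed.

(** Causality: the tests up to [s] read values before [S], or a left limit at [S] when [tau = 0]. An
    earlier event of [y] would also be one of [x]. *)
Lemma eq_next_event x y (S s : R) T T' lo : (forall u, 0 <= u < S -> x u = y u) ->
  (S%:E <= T)%E -> (s%:E < T')%E ->
  s < S \/ [/\ tau = 0, (lo < s%:E)%E & s <= S] ->
  (0 <= lo)%E -> next x T lo = s%:E -> next y T' lo = s%:E.
Proof.
move=> xy ST sT' sS lo0 nx.
have [j [j0 sE /andP[los _] Vs]] := next_event_finite _ _ _ _ delta0 nx.
have s0 : 0 < s by rewrite sE mulr_gt0// ltr0n.
have sS' : s <= S by case: sS => [/ltW|[]].
have ny : (next y T' lo <= s%:E)%E.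
  rewrite sE; apply: next_event_le; rewrite -?sE ?los//.
  by rewrite -(eq_event_state x y S).
apply/eqP; rewrite eq_le ny/= leNgt; apply/negP => ny'.
have := next_event_ge y T' lo; have := next_event_gt0 y T' lo delta0.
case nyE : (next y T' lo) => [s'| |]//; last by move: ny'; rewrite nyE.
move=> _ los'.
have [i [i0 s'E _ Vs']] := next_event_finite _ _ _ _ delta0 nyE.
have s'0 : 0 < s' by rewrite s'E mulr_gt0// ltr0n.
move: ny'; rewrite nyE lte_fin => s's.
have s'S : s' < S by rewrite (lt_le_trans s's).
suff : (next x T lo <= s'%:E)%E by rewrite nx lee_fin leNgt s's.
rewrite s'E; apply: next_event_le; rewrite -?s'E ?los' ?(lt_le_trans _ ST)// ?lte_fin//.
by rewrite (eq_event_state x y S)//; left.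
Qed.

Lemma eq_event_time x y (S s : R) T T' k : (forall u, 0 <= u < S -> x u = y u) ->
  (S%:E <= T)%E -> (S%:E <= T')%E -> s < S ->
  event x T k = s%:E -> event y T' k = s%:E.
Proof.
move=> xy ST ST'; elim: k s => [|k IH] s sS kE.
  rewrite event_timeE; apply: (eq_next_event x y S s T T') => //.
    by rewrite (lt_le_trans _ ST')// lte_fin.
  by left.
have [p [pE /andP[p0 ps]]] := event_finite _ _ _ _ kE.
have [s' [s'E ps']] := event_start_finite _ _ _ _ pE.
have s'S : s' < S by rewrite (le_lt_trans _ sS)// (le_trans _ ps)// ps' lerDl.
have IHk := IH s' s'S s'E.
rewrite event_timeE; apply: (eq_next_event x y S s T T') => //.
- by rewrite (lt_le_trans _ ST')// lte_fin.
- by left.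
- exact: event_start_ge0.
by rewrite -kE /= IHk s'E.
Qed.

(** At [S] itself [x] and [y] may differ. With [tau = 0] several consecutive events might sit at
    [S]; only the first of them tests a left limit, so the index may change. *)
Lemma eq_event_time_at x y (S : R) T T' k : (forall u, 0 <= u < S -> x u = y u) ->
  tau = 0 -> (S%:E < T)%E -> (S%:E < T')%E ->
  event x T k = S%:E -> exists l, event y T' l = S%:E.
Proof.
move=> xy t00 ST ST' kE.
have exk : exists k, event x T k == S%:E by exists k; rewrite kE.
case: (ex_minnP exk) => {kE}{}k /eqP kE kmin; exists k.
have [p [pE /andP[p0 pS]]] := event_finite _ _ _ _ kE.
(* Otherwise [S] would be 0, or the preceding event would already occur at [S], against
   minimality. *)
have pS' : p < S.
  rewrite lt_neqAle pS andbT; apply/eqP => pSE; move: pE; rewrite pSE.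
  case: k kE kmin => [|k] kE kmin.
    by case=> S0; have := event_gt0 x T 0; rewrite kE lte_fin -S0 ltxx.
  move=> /event_start_finite[s [sE]]; rewrite t00 addr0 => Ss.
  by have := kmin k; rewrite sE Ss eqxx => /(_ isT); rewrite ltnn.
have eS : event_start y T' k = event_start x T k.
  case: k kE kmin pE => [//|k] kE kmin pE.
  have [s [sE]] := event_start_finite _ _ _ _ pE; rewrite t00 addr0 => ps.
  rewrite /= sE (eq_event_time x y S s T T' k)//; [exact: ltW|exact: ltW|].
  by rewrite -ps.
rewrite event_timeE; apply: (eq_next_event x y S S T T') => //.
- exact: ltW ST.
- by right; rewrite eS pE lte_fin.
- exact: event_start_ge0.
by rewrite eS -kE event_timeE.
Qed.

End events.

(** * The closed-loop system *)

Section dynamics.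
Context {R : realType} {n : nat}.
Variables (f g : 'rV[R]_n -> 'rV[R]_n) (tau a b delta r L1 L2 mu rho : R).
Variables (V : 'rV[R]_n -> R) (alpha1 alpha2 : R -> R).
Hypotheses (hf : continuous f) (htau : 0 <= tau) (ha : 0 < a) (hb : 0 < b) (hdelta : 0 < delta).
Hypotheses (hr : 0 < r) (hA : assumptionA f g r L1 L2).
Hypothesis hB : assumptionB f g tau r V alpha1 alpha2 mu rho.
Hypothesis hmax : Num.max (expR ((mu + b) * delta)) (expR (mu * (tau + delta)))
  <= alpha1 r / a.
Hypothesis hrho : rho * expR (b * (tau + delta)) * expR (mu * delta) < 1.
Hypothesis hL : L2 + Num.sqrt (tau * L1 * (expR (2 * L1 * tau) - 1) / 2)
  < r / Kinv alpha1 (a * expR ((mu + b) * delta)).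

Local Notation event := (event_time V a b delta tau).
Local Notation start := (event_start V a b delta tau).
Local Notation state := (event_state tau).
Local Notation thr := (threshold a b).
Local Notation abar := (a * expR ((mu + b) * delta)).
Local Notation contraction := (rho * expR (b * (tau + delta)) * expR (mu * delta)).

Let hV : class_V V. Proof. by case: hB. Qed.
Let K1 : class_Kinfty alpha1. Proof. by case: hB. Qed.
Let K2 : class_Kinfty alpha2. Proof. by case: hB. Qed.
Let mu0 : 0 < mu. Proof. by case: hB => _ _ _ []. Qed.
Let rho0 : 0 < rho. Proof. by case: hB => _ _ _ []. Qed.
Let L10 : 0 < L1. Proof. by case: hA. Qed.

Let Valpha x : enorm x < r -> alpha1 (enorm x) <= V x.
Proof. by move=> xr; have [_ _ _ _ /(_ x xr)[/andP[]]] := hB. Qed.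

Let Vdini x : enorm x < r -> (dini f V x <= (mu * V x)%:E)%E.
Proof. by move=> xr; have [_ _ _ _ /(_ x xr)[]] := hB. Qed.

Let abar_le : abar <= alpha1 r.
Proof.
rewrite mulrC -ler_pdivlMr//; apply: le_trans hmax.
by rewrite le_max lexx.
Qed.

Let delay_le : a * expR (mu * (tau + delta)) <= alpha1 r.
Proof.
rewrite mulrC -ler_pdivlMr//; apply: le_trans hmax.
by rewrite le_max lexx orbT.
Qed.

Let abar0 : 0 < abar. Proof. by rewrite mulr_gt0// expR_gt0. Qed.

Let contraction0 : 0 < contraction.
Proof. by rewrite !mulr_gt0// expR_gt0. Qed.

Lemma threshold_gt0 t : 0 < thr t.
Proof. by rewrite mulr_gt0// expR_gt0. Qed.

Lemma flow_ball (z : R -> 'rV[R]_n) p q : p <= q -> flow f p q z -> enorm (z p) < r ->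
  V (z p) * expR (mu * (q - p)) < alpha1 r ->
  forall u, p <= u <= q -> enorm (z u) < r /\ V (z u) <= V (z p) * expR (mu * (u - p)).
Proof. exact: (flow_V_ball f V hV mu r alpha1 (ltW mu0) hr K1 Valpha Vdini). Qed.

(** Origin of [abar]: over one period [V] gains at most a factor [expR (mu * delta)] while the
    threshold loses at most [expR (b * delta)]. *)
Lemma sampled_step p t c : 0 <= p -> p <= t <= p + delta -> c < thr p ->
  c * expR (mu * (t - p)) < abar * expR (- (b * t)).
Proof.
move=> p0 /andP[pt td] cp.
apply: (@lt_le_trans _ _ (thr p * expR (mu * (t - p)))).
  by rewrite ltr_pM2r// expR_gt0.
rewrite /threshold -!mulrA ler_pM2l// -!expRD ler_expR.
have : (mu + b) * (t - p) <= (mu + b) * delta.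
  by rewrite ler_pM2l ?addr_gt0//; lra.
by lra.
Qed.

Lemma abar_exp_le t : 0 <= t -> abar * expR (- (b * t)) <= alpha1 r.
Proof.
move=> t0; apply: le_trans abar_le; rewrite ger_pMr// -expR0 ler_expR.
by rewrite oppr_le0 mulr_ge0// ltW.
Qed.

(** [S] limits the interval where the equation holds, [E] the one where samples stay below the
    threshold. The conclusion concerns a left limit, as [x t] may already include a jump. The
    induction is on the number of sampling periods. *)
Lemma sampled_bound (x : R -> 'rV[R]_n) (lo : R) (S E : \bar R) : 0 <= lo ->
  x u @[u --> lo^'+] --> x lo ->
  (forall t : R, lo < t -> (t%:E < S)%E -> is_derive t 1 x (f (x t))) ->
  enorm (x lo) < r -> V (x lo) < thr lo ->
  (forall j, (0 < j)%N -> lo < j%:R * delta -> ((j%:R * delta)%:E < S)%E ->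
     ((j%:R * delta)%:E < E)%E -> V (x (j%:R * delta)) < thr (j%:R * delta)) ->
  forall t l, lo < t -> (t%:E <= E)%E -> (t%:E <= S)%E -> x u @[u --> t^'-] --> l ->
  enorm l < r /\ V l < abar * expR (- (b * t)).
Proof.
move=> lo0 xlo dx xr Vlo Vj.
have main N : forall t l, lo < t -> t <= N%:R * delta -> (t%:E <= E)%E -> (t%:E <= S)%E ->
    x u @[u --> t^'-] --> l -> enorm l < r /\ V l < abar * expR (- (b * t)).
  elim: N => [|N IH] t l lot tN tE tS xl.
    by move: tN; rewrite mul0r leNgt (le_lt_trans lo0).
  have [tN'|tN'] := leP t (N%:R * delta); first exact: IH xl.
  (* The last time before [t] at which [V] is known to be below the threshold: a sampling time, or
     [lo] if none lies in between. *)
  pose p := Num.max lo (N%:R * delta).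
  have lop : lo <= p by rewrite le_max lexx.
  have p0 : 0 <= p by rewrite (le_trans lo0).
  have pt : p < t by rewrite gt_max lot.
  have tp : p <= t <= p + delta.
    rewrite ltW//= (le_trans tN)// -natr1 mulrDl mul1r lerD2r.
    by rewrite le_max lexx orbT.
  have pS : (p%:E < S)%E by rewrite (lt_le_trans _ tS)// lte_fin.
  have pE : (p%:E < E)%E by rewrite (lt_le_trans _ tE)// lte_fin.
  have [xp xpr Vp] : [/\ x u @[u --> p^'+] --> x p, enorm (x p) < r & V (x p) < thr p].
    have [Nlo|loN] := leP (N%:R * delta) lo.
      by have -> : p = lo by rewrite /p max_l.
    have pN : p = N%:R * delta by rewrite /p max_r// ltW.
    have dp := dx p; rewrite pN loN -pN in dp.
    have {}dp := dp isT pS.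
    have cp := is_derive1_continuous _ _ _ dp.
    split.
    - exact: cvg_at_right_filter.
    - apply: (IH p (x p) _ _ (ltW pE) (ltW pS) _).1; rewrite ?pN//.
      by rewrite -pN; exact: cvg_at_left_filter.
    - rewrite pN; apply: Vj; rewrite -?pN//; last by rewrite pN.
      by rewrite lt0n; apply: contraTN loN => /eqP ->; rewrite mul0r -leNgt.
  have fl : flow f p t (fun u => if u < t then x u else l).
    apply: (flow_left_limit f x p t l) => // u /andP[pu ut]; apply: dx.
      exact: le_lt_trans pu.
    by rewrite (lt_le_trans _ tS)// lte_fin.
  have step := sampled_step p t _ p0 tp Vp.
  have := flow_ball _ _ _ (ltW pt) fl; rewrite pt => /(_ xpr).
  move=> /(_ (lt_le_trans step (abar_exp_le _ (ltW (le_lt_trans p0 pt))))) /(_ t).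
  rewrite lexx (ltW pt) => /(_ isT); rewrite ltxx => -[-> Vl]; split=> //.
  exact: le_lt_trans Vl step.
move=> t l lot; have t0 : 0 < t by exact: le_lt_trans lot.
apply: (main (Num.truncn (t / delta)).+1) => //.
have /andP[_] := truncn_step delta t hdelta (ltW t0).
by rewrite -natr1 mulrDl mul1r => /ltW.
Qed.

(** Splitting [y tau + g v] as [(v + g v) + (y tau - v)] produces the two terms on the left of [hL]:
    the first is bounded through [L2], the second by [flow_growth]. The bound on [V v] gives the
    common factor [Kinv alpha1 abar]. *)
Lemma jump_norm y v : flow f 0 tau y -> y 0 = v -> enorm v < r -> V v < abar ->
  (forall u, 0 < u < tau -> enorm (y u) < r) -> enorm (y tau + g v) < r.
Proof.
move=> fy yv vr Vv yr.
have [_ L20 hA'] := hA.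
have grow : enorm (y tau - v) <= (expR (L1 * tau) - 1) * enorm v.
  have := flow_growth f y 0 tau L1 htau (ltW L10) fy.
  rewrite yv subr0; apply => u utau.
  by have [] := hA' _ (yr u utau).
have vK : enorm v <= Kinv alpha1 abar.
  rewrite -(Kinfty_le _ K1) ?enorm_ge0//; last by apply: Kinv_ge0 => //; exact: ltW.
  by rewrite KinvK ?(ltW abar0)// (le_trans (Valpha _ vr))// ltW.
have K0 : 0 < Kinv alpha1 abar.
  have := Kinv_ge0 _ K1 _ (ltW abar0); rewrite le_eqVlt => /orP[/eqP E|//].
  have := KinvK _ K1 _ (ltW abar0); rewrite -E; have [_ _ -> _] := K1 => E0.
  by move: abar0; rewrite -E0 ltxx.
have -> : y tau + g v = (v + g v) + (y tau - v) by apply/rowP => i; rewrite !mxE; ring.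
apply: le_lt_trans (ler_enormD _ _) _.
have [_ vg] := hA' _ vr.
have e1 := expR_sub1_le_sqrt (L1 * tau) (mulr_ge0 (ltW L10) htau).
have := hL; rewrite ltr_pdivlMr//; apply: le_lt_trans.
rewrite mulrDl lerD//.
  by rewrite (le_trans vg)// ler_pM2l.
rewrite (le_trans grow)// ler_pM ?enorm_ge0//.
  by rewrite subr_ge0 -expR0 ler_expR mulr_ge0// ltW.
by rewrite (le_trans e1)// ler_wsqrtr// (mulrC tau) mulrA.
Qed.

(** Events occur at positive multiples of [delta], whence [delta <= s]: the factor
    [expR (- (b * s))] then compensates [expR (b * delta)] in [abar], and after the delay [V] is
    still bounded by [a] times the second term of the maximum. *)
Lemma jump s y v : delta <= s -> flow f s (s + tau) y -> y s = v -> enorm v < r ->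
  V v < abar * expR (- (b * s)) ->
  [/\ forall u, s <= u <= s + tau ->
        enorm (y u) < r /\ V (y u) <= V v * expR (mu * (u - s)),
      enorm (y (s + tau) + g v) < r &
      V (y (s + tau) + g v) < contraction * thr (s + tau)].
Proof.
move=> ds fy yv vr Vv.
have s0 : 0 <= s by rewrite (le_trans (ltW hdelta)).
have ball : forall u, s <= u <= s + tau ->
    enorm (y u) < r /\ V (y u) <= V v * expR (mu * (u - s)).
  have := flow_ball y s (s + tau); rewrite lerDl htau yv => /(_ isT fy vr); apply.
  apply: lt_le_trans delay_le.
  apply: (@lt_le_trans _ _ (abar * expR (- (b * s)) * expR (mu * (s + tau - s)))).
    by rewrite ltr_pM2r// expR_gt0.
  rewrite -!mulrA ler_pM2l// -!expRD ler_expR.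
  have : b * delta <= b * s by rewrite ler_pM2l.
  by lra.
have Vv' : V v < abar.
  rewrite (lt_le_trans Vv)// ger_pMr// -expR0 ler_expR.
  by rewrite oppr_le0 mulr_ge0// ltW.
have fy0 : flow f 0 tau (fun u => y (u + s)).
  by have := flow_shift f y s (s + tau) s fy; rewrite subrr addrAC subrr add0r.
have in_ball : forall u, 0 <= u <= tau -> enorm (y (u + s)) < r.
  by move=> u /andP[u0 ut]; apply: (ball _ _).1; apply/andP; split; lra.
have jr : enorm (y (s + tau) + g v) < r.
  have := jump_norm (fun u => y (u + s)) v fy0; rewrite add0r => /(_ yv vr Vv').
  rewrite [tau + s]addrC; apply => u /andP[u0 ut].
  by apply: in_ball; rewrite !ltW.
split=> //.
have [_ _ _ _ /(_ v vr)[_ _ iii]] := hB.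
have := iii (fun u => y (u + s)); rewrite [tau + s]addrC.
have ivp : ivp_solution f tau v (fun u => y (u + s)).
  by split; [rewrite add0r|exact: fy0.1|exact: fy0.2].
move=> /(_ ivp) Vj; apply: le_lt_trans (Vj _ jr) _.
  by apply: (ball _ _).1; rewrite lexx lerDl htau.
rewrite /threshold.
(* [contraction] is the constant that expresses [rho] times the bound at the event time as a
   multiple of the threshold at the impulse time. *)
have -> : contraction * (a * expR (- (b * (s + tau)))) = rho * (abar * expR (- (b * s))).
  have -> : contraction * (a * expR (- (b * (s + tau)))) =
    rho * (a * (expR (b * (tau + delta)) * expR (mu * delta) * expR (- (b * (s + tau))))).
    by ring.
  congr (_ * _); rewrite -[RHS]mulrA -!expRD; congr (_ * expR _); ring.
by rewrite ltr_pM2l.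
Qed.


(** * Estimates along one solution, segment by segment *)

Section trajectory.
Variables (x : R -> 'rV[R]_n) (T : \bar R) (x0 : 'rV[R]_n).
Hypothesis hsol : solution f g V a b delta tau T x x0.
Hypotheses (x0r : enorm x0 < r) (x0a : V x0 < a).

Lemma segment_derive k t : (start x T k < t%:E)%E -> (t%:E < event x T k + tau%:E)%E ->
  (t%:E < T)%E -> is_derive t 1 x (f (x t)).
Proof.
move=> kt tk tT; have [_ _ dx _] := hsol.
have t0 : 0 < t.
  rewrite -lte_fin; apply: le_lt_trans kt.
  exact: (event_start_ge0 V a b delta tau hdelta htau).
apply: dx => // i; have [ik|ki] := ltnP i k.
  rewrite lt_eqF//; apply: le_lt_trans kt.
  exact: (event_start_nd V a b delta tau htau x T i.+1 k ik).
rewrite gt_eqF//; apply: lt_le_trans tk _.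
exact: (event_start_nd V a b delta tau htau x T k.+1 i.+1 ki).
Qed.

Lemma prejump_derive (t : R) (d : 'rV[R]_n) : is_derive t 1 x d -> prejump tau x t = x t.
Proof.
move=> dx; rewrite /prejump; case: eqP => // _.
by apply: cvg_lim => //; apply: cvg_at_left_filter; exact: is_derive1_continuous dx.
Qed.

(** Invariant passed from one impulse to the next. The strict inequality on [V] excludes an event at
    [p] itself. *)
Definition below_threshold k p :=
  [/\ start x T k = p%:E, (p%:E < T)%E, x u @[u --> p^'+] --> x p,
      enorm (x p) < r & V (x p) < thr p].

Section segment.
Variables (k : nat) (p : R).
Hypothesis kp : below_threshold k p.

Let pE : start x T k = p%:E. Proof. by case: kp. Qed.

Let p0 : 0 <= p.
Proof.
have := event_start_ge0 V a b delta tau hdelta htau x T k.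
by rewrite pE lee_fin.
Qed.

Let derive_p t : p < t -> (t%:E < event x T k + tau%:E)%E -> (t%:E < T)%E ->
  is_derive t 1 x (f (x t)).
Proof. by move=> pt; apply: segment_derive; rewrite pE lte_fin. Qed.

(** Before the impulse the trajectory is differentiable, so its value is its left limit. The
    remaining case is [tau = 0] with [t] the event time: there [prejump] is the left limit, which
    exists by the impulse clause of [solution]. *)
Lemma event_state_limit t : p < t -> (t%:E <= event x T k)%E -> (t%:E < T)%E ->
  x u @[u --> t^'-] --> state x p%:E t.
Proof.
move=> pt tE tT; rewrite /event_state lte_fin pt.
have [tk|kt] := ltP t%:E (event x T k + tau%:E)%E.
  have dx := derive_p t pt tk tT.
  rewrite (prejump_derive _ _ dx); apply: cvg_at_left_filter.
  exact: is_derive1_continuous dx.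
case kE : (event x T k) => [s| |]; rewrite kE// in tE kt.
move: tE kt; rewrite !lee_fin => ts st.
have tau00 : tau = 0 by apply/eqP; rewrite eq_le htau andbT; lra.
have sE : s = t by move: st; rewrite tau00; lra.
have [_ _ _ /(_ k s kE)] := hsol; rewrite tau00 addr0 sE => /(_ tT)[ct _ _].
by rewrite /prejump eqxx.
Qed.

Lemma state_bound t : p <= t -> (t%:E <= event x T k)%E -> (t%:E < T)%E ->
  [/\ enorm (state x p%:E t) < r, V (state x p%:E t) < abar * expR (- (b * t)) &
      V (state x p%:E t) <= V (x p) * expR (mu * (t - p))].
Proof.
have [_ pT xp xpr Vp] := kp.
rewrite le_eqVlt => /orP[/eqP <- _ _|pt tE tT].
  rewrite /event_state ltxx; split=> //; last by rewrite subrr mulr0 expR0 mulr1.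
  have := sampled_step p p (V (x p)) p0.
  rewrite lexx lerDl (ltW hdelta) subrr mulr0 expR0 mulr1; exact.
have lim u : p < u -> (u%:E <= event x T k)%E -> (u%:E < T)%E ->
    enorm (state x p%:E u) < r /\ V (state x p%:E u) < abar * expR (- (b * u)).
  move=> pu uE uT.
  apply: (sampled_bound x p (Order.min (event x T k + tau%:E)%E T) (event x T k)) => //.
  - by move=> v pv; rewrite lt_min => /andP[vk vT]; exact: derive_p.
  - move=> j j0 pj; rewrite lt_min => /andP[jk jT] jE.
    have := lt_next_event V a b delta tau x T p%:E j j0.
    rewrite lee_fin (ltW pj) jT => /(_ isT); rewrite -pE -event_timeE => /(_ jE).
    by rewrite pE /event_state lte_fin pj (prejump_derive _ _ (derive_p _ pj jk jT)).
  - rewrite le_min (ltW uT) andbT (le_trans uE)// leeDl// lee_fin//.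
  - exact: event_state_limit.
have [tr tV] := lim t pt tE tT; split=> //.
have fl : flow f p t (fun u => if u < t then x u else state x p%:E t).
  apply: (flow_left_limit f x p t) => //; last exact: event_state_limit.
  move=> u /andP[pu ut]; apply: derive_p => //.
    by rewrite (lt_le_trans _ (le_trans tE _)) ?lte_fin// leeDl// lee_fin.
  by rewrite (lt_trans _ tT)// lte_fin.
have := flow_V_growth f V hV mu r (ltW mu0) Vdini _ p t (ltW pt) fl.
rewrite ltxx pt; apply => u /andP[pu ut]; rewrite ut.
have uE : (u%:E < event x T k)%E by rewrite (lt_le_trans _ tE)// lte_fin.
have uT : (u%:E < T)%E by rewrite (lt_trans _ tT)// lte_fin.
have [+ _] := lim u pu (ltW uE) uT; rewrite /event_state lte_fin pu.
rewrite (prejump_derive _ _ (derive_p _ pu _ uT))//.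
by rewrite (lt_le_trans uE)// leeDl// lee_fin.
Qed.

Lemma event_after_start s : event x T k = s%:E ->
  [/\ p < s, delta <= s, (s%:E < T)%E & thr s <= V (prejump tau x s)].
Proof.
move=> kE; have [_ pT _ _ Vp] := kp.
have := kE; rewrite event_timeE => nE.
have [j [j0 sE /andP[ps sT]]] := next_event_finite V a b delta tau x T _ s hdelta nE.
move: ps; rewrite pE lee_fin /event_state lte_fin le_eqVlt => /orP[/eqP ps|ps].
  by rewrite -ps ltxx leNgt Vp.
rewrite ps => sV; split=> //; rewrite sE ler_peMl ?(ltW hdelta)// ler1n//.
Qed.

Lemma event_growth s : event x T k = s%:E ->
  thr s <= V (x p) * expR (mu * (s - p)).
Proof.
move=> kE; have [ps _ sT sV] := event_after_start s kE.
have sk : (s%:E <= event x T k)%E by rewrite kE.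
have [_ _] := state_bound s (ltW ps) sk sT.
by rewrite /event_state lte_fin ps; exact: le_trans.
Qed.

Lemma prejump_bound s : event x T k = s%:E ->
  enorm (prejump tau x s) < r /\ V (prejump tau x s) < abar * expR (- (b * s)).
Proof.
move=> kE; have [ps _ sT _] := event_after_start s kE.
have sk : (s%:E <= event x T k)%E by rewrite kE.
by have [] := state_bound s (ltW ps) sk sT; rewrite /event_state lte_fin ps.
Qed.

Lemma delay_derive s t : event x T k = s%:E -> s <= t -> t < s + tau -> (t%:E < T)%E ->
  is_derive t 1 x (f (x t)).
Proof.
move=> kE st ts tT; have [ps _ sT _] := event_after_start s kE.
apply: derive_p => //; first exact: lt_le_trans st.
by rewrite kE lte_fin.
Qed.

Lemma delay_bound s t : event x T k = s%:E -> s <= t -> t < s + tau -> (t%:E < T)%E ->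
  enorm (x t) < r /\ V (x t) <= abar * expR (- (b * s)) * expR (mu * (t - s)).
Proof.
move=> kE st ts tT; have [ps ds sT _] := event_after_start s kE.
have [vr vV] := prejump_bound s kE.
have dx u : s <= u <= t -> is_derive u 1 x (f (x u)).
  move=> /andP[su ut]; apply: (delay_derive s) => //; first exact: le_lt_trans ts.
  by rewrite (le_lt_trans _ tT)// lee_fin.
have xs : prejump tau x s = x s by apply: prejump_derive (dx s _); rewrite lexx.
move: vr vV; rewrite xs => vr vV.
have fl : flow f s t x.
  split; last by move=> u /andP[su ut]; apply: dx; rewrite !ltW.
  apply: continuous_in_subspaceT => u; rewrite inE/= in_itv/= => ust.
  exact: is_derive1_continuous (dx u ust).
have Vs : V (x s) * expR (mu * (t - s)) < alpha1 r.
  apply: lt_le_trans delay_le.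
  apply: (@lt_le_trans _ _ (abar * expR (- (b * s)) * expR (mu * (t - s)))).
    by rewrite ltr_pM2r// expR_gt0.
  rewrite -!mulrA ler_pM2l// -!expRD ler_expR.
  have : b * delta <= b * s by rewrite ler_pM2l.
  have : mu * (t - s) <= mu * tau by rewrite ler_pM2l//; lra.
  by lra.
have := flow_ball x s t st fl vr Vs t; rewrite st lexx => /(_ isT)[-> Vt].
by split=> //; rewrite (le_trans Vt)// ler_pM2r ?expR_gt0// ltW.
Qed.

Lemma impulse s : event x T k = s%:E -> ((s + tau)%:E < T)%E ->
  [/\ x u @[u --> (s + tau)^'+] --> x (s + tau), enorm (x (s + tau)) < r &
      V (x (s + tau)) < contraction * thr (s + tau)].
Proof.
move=> kE sT; have [ps ds sT' _] := event_after_start s kE.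
have [vr vV] := prejump_bound s kE.
have [_ _ _ /(_ k s kE sT)[cl cr xj]] := hsol.
set l := lim _ in cl xj.
have xE : x (s + tau) = l + g (prejump tau x s) by rewrite -xj subrKC.
(* The flow over the delay ends at the left limit, not at the jumped state. For [tau = 0] the
   interval is a point and its value is the state before the jump. *)
have jumpE := jump s (fun u => if u < s + tau then x u else l) (prejump tau x s) ds.
rewrite ltxx -xE in jumpE.
suff [fl ys] : flow f s (s + tau) (fun u => if u < s + tau then x u else l) /\
    (if s < s + tau then x s else l) = prejump tau x s.
  by have [_ ? ?] := jumpE fl ys vr vV.
have [tau00|tau0] := eqVneq tau 0.
  split.
    rewrite /flow tau00 addr0; split.
      by rewrite set_itv1; exact: continuous_subspace1.
    by move=> t /andP[st ts]; have := lt_trans st ts; rewrite ltxx.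
  by rewrite tau00 addr0 ltxx /prejump eqxx /l tau00 addr0.
have tau0' : 0 < tau by rewrite lt_def tau0.
have dx t : s <= t < s + tau -> is_derive t 1 x (f (x t)).
  move=> /andP[st ts]; apply: (delay_derive s) => //.
  by rewrite (lt_trans _ sT)// lte_fin.
split; last by rewrite ltrDl tau0' /prejump (negPf tau0).
have s_lt : s < s + tau by rewrite ltrDl.
have xs : x u @[u --> s^'+] --> x s.
  apply: cvg_at_right_filter; apply: is_derive1_continuous (dx s _).
  by rewrite lexx.
have dx' t : s < t < s + tau -> is_derive t 1 x (f (x t)).
  by move=> /andP[st ts]; apply: dx; rewrite ltW.
exact: (flow_left_limit f x s (s + tau) l s_lt xs dx' cl).
Qed.

(** In the constant, [delta] accounts for the time between samples and [tau] for the delay after an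
    event, when [V] may keep growing. *)
Lemma segment_bound t : p <= t -> (t%:E < T)%E -> (t%:E < event x T k + tau%:E)%E ->
  enorm (x t) < r /\
  V (x t) <= a * expR ((mu + b) * (tau + delta)) * expR (- (b * t)).
Proof.
move=> pt tT tk.
have [tE|Et] := leP t%:E (event x T k).
  have [] := state_bound t pt tE tT.
  have -> : state x p%:E t = x t.
    rewrite /event_state lte_fin; case: ifPn => // pt'.
    exact: prejump_derive (derive_p t pt' tk tT).
  move=> -> Vt _; split=> //; rewrite (le_trans (ltW Vt))//.
  rewrite ler_pM2r ?expR_gt0// ler_pM2l// ler_expR.
  by rewrite ler_pM2l ?addr_gt0// lerDr.
case kE : (event x T k) => [s| |]; rewrite kE// in Et tk.
move: Et tk; rewrite !lte_fin => st ts.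
have [-> Vt] := delay_bound s t kE (ltW st) ts tT; split=> //.
rewrite (le_trans Vt)// -!mulrA ler_pM2l// -!expRD ler_expR.
have : (mu + b) * (t - s) <= (mu + b) * tau by rewrite ler_pM2l ?addr_gt0//; lra.
by lra.
Qed.

End segment.

(** Initially only [V x0 < a] is available, hence the guard [0 < k]. After an impulse the factor
    [contraction] is kept: it is the room that [event_gap] converts into time. *)
Lemma below_thresholdP k p : start x T k = p%:E -> (p%:E < T)%E ->
  below_threshold k p /\ ((0 < k)%N -> V (x p) < contraction * thr p).
Proof.
elim: k p => [|k IH] p pE pT.
  have [_ [x0E x0c] _ _] := hsol; have {pE} <- : 0 = p by case: pE.
  split=> //; split; [by []|by case: hsol|exact: x0c|by rewrite x0E|].
  by rewrite x0E /threshold mulr0 oppr0 expR0 mulr1.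
have [s [kE ps]] := event_start_finite _ _ _ _ _ _ _ _ _ pE.
have [p' [pE' /andP[_ p's]]] := event_finite _ _ _ _ _ hdelta htau _ _ _ _ kE.
have p'T : (p'%:E < T)%E.
  by rewrite (le_lt_trans _ pT)// lee_fin ps (le_trans p's)// lerDl.
have [kp _] := IH p' pE' p'T.
have := impulse k p' kp s kE; rewrite -ps => /(_ pT)[cp pr Vp].
split=> //; split=> //; rewrite (lt_trans Vp)//.
by rewrite gtr_pMl ?threshold_gt0.
Qed.

Lemma event_below k s : event x T k = s%:E -> exists p, below_threshold k p.
Proof.
move=> kE.
have [p [pE /andP[_ ps]]] := event_finite _ _ _ _ _ hdelta htau _ _ _ _ kE.
have := kE; rewrite event_timeE.
move=> /(next_event_finite _ _ _ _ _ _ _ _ _ hdelta)[j [_ _ /andP[_ sT] _]].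
by exists p; apply: (below_thresholdP _ _ pE _).1; rewrite (le_lt_trans _ sT)// lee_fin.
Qed.

Lemma event_gap k s : event x T k.+1 = s%:E ->
  exists s', event x T k = s'%:E /\ tau - ln contraction / (b + mu) < s - s'.
Proof.
move=> kE; have [p kp] := event_below _ _ kE.
have [pE pT _ _ _] := kp.
have [s' [sE' ps']] := event_start_finite _ _ _ _ _ _ _ _ _ pE.
exists s'; split=> //.
have [_ /(_ isT) Vp] := below_thresholdP _ _ pE pT.
move: contraction0 Vp; set c := contraction => c0 Vp.
have : thr s < c * thr p * expR (mu * (s - p)).
  apply: le_lt_trans (event_growth _ _ kp _ kE) _.
  by rewrite ltr_pM2r// expR_gt0.
have bmu : 0 < b + mu by rewrite addr_gt0.
(* In logarithms: [- b * s < ln c - b * p + mu * (s - p)], where [p] is the previous event time plus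
   [tau]. *)
rewrite -[X in X * thr p](lnK c0) /threshold.
rewrite -mulrA mulrCA -!mulrA ltr_pM2l// -!expRD ltr_expR => H.
suff : - ln c / (b + mu) < s - p by rewrite mulNr ps'; lra.
by rewrite ltr_pdivrMr//; lra.
Qed.


Lemma gap_gt_tau : tau < tau - ln contraction / (b + mu).
Proof.
rewrite ltrBrDl -ltrBrDr subrr pmulr_llt0 ?invr_gt0 ?addr_gt0//.
by rewrite ln_lt0// contraction0.
Qed.

Lemma event_lower_bound k :
  ((k%:R * (tau - ln contraction / (b + mu)))%:E <= event x T k)%E.
Proof.
have G0 := le_lt_trans htau gap_gt_tau.
elim: k => [|k IH]; first by rewrite mul0r ltW// event_gt0.
have := event_gt0 V a b delta tau hdelta x T k.+1.
case kE : (event x T k.+1) => [s| |]// _.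
  have [s' [sE' gap]] := event_gap _ _ kE.
  by move: IH; rewrite sE' !lee_fin -natr1 mulrDl mul1r; lra.
by rewrite leey.
Qed.

(** [P] is abstract to serve both a strict comparison, for a time inside [[0, T)], and a non-strict
    one, for a finite end [T]; the margin 1 suits both. Existence comes from the linear growth of
    event times. *)
Lemma first_event_index (t : R) (P : \bar R -> bool) : 0 <= t ->
  (forall e, ((t + 1)%:E <= e)%E -> P e) ->
  exists k, P (event x T k + tau%:E)%E /\
    forall i, (i < k)%N -> ~~ P (event x T i + tau%:E)%E.
Proof.
move=> t0 HP; have := event_lower_bound.
have := le_lt_trans htau gap_gt_tau; set G := tau - _ => G0 EG.
have {}EG i : ((i%:R * G)%:E <= event x T i + tau%:E)%E.
  by rewrite (le_trans (EG i))// leeDl// lee_fin.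
have exk : exists k, P (event x T k + tau%:E)%E.
  exists (Num.truncn ((t + 1) / G)).+1; apply: HP.
  apply: le_trans (EG _).
  rewrite lee_fin -ler_pdivrMr//.
  have /truncn_itv/andP[_ /ltW//] : 0 <= (t + 1) / G.
  by rewrite divr_ge0 ?(ltW G0)// addr_ge0.
case: (ex_minnP exk) => k Pk kmin; exists k; split=> // i ik.
by apply/negP => /kmin; rewrite leqNgt ik.
Qed.

Lemma segment_of t : 0 <= t -> (t%:E < T)%E ->
  exists k p, [/\ below_threshold k p, p <= t & (t%:E < event x T k + tau%:E)%E].
Proof.
move=> t0 tT.
have [e|k [kt kmin]] := first_event_index t (fun e => (t%:E < e)%E) t0.
  by apply: lt_le_trans; rewrite lte_fin ltrDl.
have startk : (start x T k <= t%:E)%E.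
  case: k kt kmin => [|k] kt kmin /=; first by rewrite lee_fin.
  by have := kmin k (ltnSn k); rewrite -leNgt.
have := event_start_ge0 V a b delta tau hdelta htau x T k.
case kE : (start x T k) => [p| |]; rewrite kE// in startk * => p0.
exists k, p; split=> //.
by apply: (below_thresholdP _ _ kE _).1; apply: le_lt_trans tT.
Qed.

Lemma last_segment (S : R) : T = S%:E -> exists k p,
  [/\ below_threshold k p, p < S & (S%:E <= event x T k + tau%:E)%E].
Proof.
move=> TS.
have S0 : 0 < S by rewrite -lte_fin -TS; case: hsol.
have [e|k [kt kmin]] := first_event_index S (fun e => (S%:E <= e)%E) (ltW S0).
  by apply: le_trans; rewrite lee_fin lerDl.
have startk : (start x T k < S%:E)%E.
  case: k kt kmin => [|k] kt kmin /=; first by rewrite lte_fin.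
  by have := kmin k (ltnSn k); rewrite -ltNge.
have := event_start_ge0 V a b delta tau hdelta htau x T k.
case kE : (start x T k) => [p| |]; rewrite kE// in startk * => p0.
exists k, p; split=> //.
by apply: (below_thresholdP _ _ kE _).1; rewrite TS.
Qed.

Lemma trajectory_bound t : 0 <= t -> (t%:E < T)%E ->
  enorm (x t) < r /\
  V (x t) <= a * expR ((mu + b) * (tau + delta)) * expR (- (b * t)).
Proof.
move=> t0 tT; have [k [p [kp pt tk]]] := segment_of t t0 tT.
exact: segment_bound kp t pt tT tk.
Qed.

Lemma last_flow (S : R) : T = S%:E -> exists p, [/\ 0 <= p, p < S,
   x u @[u --> p^'+] --> x p,
   forall t, p < t < S -> is_derive t 1 x (f (x t)) & cvg (x u @[u --> S^'-])].
Proof.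
move=> TS; have [k [p [kp pS Sk]]] := last_segment S TS.
have [pE _ xp _ _] := kp.
have p0 : 0 <= p.
  by have := event_start_ge0 V a b delta tau hdelta htau x T k; rewrite pE lee_fin.
have dx t : p < t < S -> is_derive t 1 x (f (x t)).
  move=> /andP[pt tS]; apply: (segment_derive k); first by rewrite pE lte_fin.
    by rewrite (lt_le_trans _ Sk)// lte_fin.
  by rewrite TS lte_fin.
exists p; split=> //.
apply: (bounded_left_limit f x p S (L1 * r)) => // t tpS; split; first exact: dx.
have /andP[pt tS] := tpS.
have [tr _] : enorm (x t) < r /\
  V (x t) <= a * expR ((mu + b) * (tau + delta)) * expR (- (b * t)).
  apply: trajectory_bound; first by rewrite (le_trans p0)// ltW.
  by rewrite TS lte_fin.
have [_ _ /(_ _ tr)[fx _]] := hA.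
by rewrite (le_trans fx)// ler_pM2l// ltW.
Qed.

Lemma early_state_bound t : 0 <= t -> (t%:E < event x T 0)%E -> (t%:E < T)%E ->
  V (x t) <= V x0 * expR (mu * t).
Proof.
move=> t0 tE tT; have [T0 [x0E _] _ _] := hsol.
have [k0 _] := below_thresholdP 0 0 erefl T0.
have [_ _] := state_bound 0 0 k0 t t0 (ltW tE) tT.
rewrite x0E subr0 /event_state lte_fin; case: ifPn => // tp.
have dxt : is_derive t 1 x (f (x t)).
  apply: (segment_derive 0) => //.
  by rewrite (lt_le_trans tE)// leeDl// lee_fin.
by rewrite (prejump_derive t _ dxt).
Qed.

Lemma first_event_threshold s : event x T 0 = s%:E -> thr s <= V x0 * expR (mu * s).
Proof.
move=> sE; have [T0 [x0E _] _ _] := hsol.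
have [k0 _] := below_thresholdP 0 0 erefl T0.
by have := event_growth 0 0 k0 s sE; rewrite x0E subr0.
Qed.

(** * Continuation past a finite end point *)

Section extension.
Variables (S e : R) (l : 'rV[R]_n) (y : R -> 'rV[R]_n).
Hypothesis TS : T = S%:E.
Hypothesis xl : x u @[u --> S^'-] --> l.
Hypothesis e0 : 0 < e.
Hypothesis no_impulse : forall j, ~~ (S < j%:R * delta + tau < S + e).
Hypothesis yx : forall u, 0 <= u < S -> x u = y u.
Hypothesis yS : y u @[u --> S^'+] --> y S.
Hypothesis dy : forall t, S < t < S + e -> is_derive t 1 y (f (y t)).
Hypothesis no_jump :
  (forall k, event y (S + e)%:E k != (S - tau)%:E) -> y S = l.
Hypothesis jumpS : forall k, event y (S + e)%:E k = (S - tau)%:E ->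
  y S = l + g (prejump tau y (S - tau)).

Let S0 : 0 < S. Proof. by rewrite -lte_fin -TS; case: hsol. Qed.

Let near_yx t : 0 < t < S -> \forall u \near t, x u = y u.
Proof.
move=> /andP[t0 tS]; near=> u; apply: yx; apply/andP; split.
  by apply: ltW; near: u; exact: lt_nbhsr.
by near: u; exact: lt_nbhsl.
Unshelve. all: by end_near. Qed.

Let near_yx_left t : 0 < t <= S -> \forall u \near t^'-, x u = y u.
Proof.
move=> /andP[t0 tS]; near=> u; apply: yx; apply/andP; split.
  by apply: ltW; near: u; exact: nbhs_left_gt.
by rewrite (lt_le_trans _ tS)//; near: u; exact: nbhs_left_lt.
Unshelve. all: by end_near. Qed.

Let y_left t (v : 'rV[R]_n) : 0 < t <= S -> x u @[u --> t^'-] --> v -> y u @[u --> t^'-] --> v.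
Proof.
move=> tS xv; apply: cvg_trans xv; apply: near_eq_cvg.
exact: near_yx_left.
Qed.

(** Before [S] the events of [y] are those of [x] by causality. At [S] either [jumpS] gives the
    impulse clause, or [y S] is the left limit and [flow_glue] gives the derivative. After [S] no
    impulse is possible, since impulse times have the form [j%:R * delta + tau]. *)
Lemma extension_solution : solution f g V a b delta tau (S + e)%:E y x0.
Proof.
have [_ [x0E x0c] dx jx] := hsol.
have SSe : (S%:E <= (S + e)%:E)%E by rewrite lee_fin lerDl ltW.
split.
- by rewrite lte_fin addr_gt0.
- rewrite -yx ?lexx//; split=> //.
  apply: cvg_trans x0c; apply: near_eq_cvg; near=> u; apply: yx; apply/andP; split.
    by apply: ltW; near: u; exact: nbhs_right_gt.
  by near: u; exact: nbhs_right_lt.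
- move=> t t0; rewrite lte_fin => tSe ty.
  have [tS|St|tS] := ltgtP t S.
  + rewrite -yx ?tS ?ltW//.
    apply: (near_eq_is_derive (near_yx t _)); first by rewrite t0.
    apply: dx => //; first by rewrite TS lte_fin.
    move=> k; apply: contra (ty k) => /eqP kt.
    have : exists s, event x T k = s%:E /\ s + tau = t.
      case: (event x T k) kt => [s| |]//= [st]; by exists s.
    move=> [s [kE st]].
    rewrite (eq_event_time V a b delta tau hdelta htau x y S s T (S + e)%:E k)//.
    * by rewrite -EFinD st.
    * by rewrite TS.
    * by rewrite (le_lt_trans _ tS)// -st lerDl.
  + by apply: dy; rewrite St.
  + subst t.
    have yl : y S = l.
      apply: no_jump => k; apply: contra (ty k) => /eqP ->.
      by rewrite -EFinD subrK.
    have [p [p0 pS xp dxp _]] := last_flow S TS.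
    apply: (flow_glue f y p S (S + e / 2) hf pS); first by rewrite ltrDl divr_gt0.
      apply: eq_flow (flow_left_limit f x p S l pS xp dxp xl) => u /andP[pu].
      rewrite le_eqVlt => /orP[/eqP ->|uS]; first by rewrite ltxx yl.
      by rewrite uS yx// uS (le_trans p0).
    apply: flow_closed => //; first by rewrite ltrDl divr_gt0.
    move=> t /andP[St tS]; apply: dy; rewrite St (le_lt_trans tS)// ltrD2l.
    by rewrite gtr_pMr// invf_lt1 ?ltr1n.
move=> k s kE; rewrite lte_fin => sSe.
have s0 : 0 < s by rewrite -lte_fin -kE event_gt0.
have := kE; rewrite event_timeE.
move=> /(next_event_finite _ _ _ _ _ _ _ _ _ hdelta)[j [_ sj _ _]].
have := no_impulse j; rewrite -sj sSe andbT -leNgt le_eqVlt => /orP[/eqP sS|sS].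
  have sS' : s = S - tau by rewrite -sS addrK.
  rewrite sS; have yl : y u @[u --> S^'-] --> l by apply: y_left; rewrite ?S0 ?lexx.
  split=> //; first by apply/cvg_ex; exists l.
  rewrite (cvg_lim _ yl)// (jumpS k); last by rewrite kE sS'.
  by rewrite sS' addrAC subrr add0r.
have sS' : s < S by rewrite (le_lt_trans _ sS)// lerDl.
have kxE : event x T k = s%:E.
  apply: (eq_event_time V a b delta tau hdelta htau y x S s (S + e)%:E T k) => //.
    by move=> u uS; rewrite yx.
  by rewrite TS.
have := jx k s kxE; rewrite TS lte_fin => /(_ sS)[cl cr xj].
have st0 : 0 < s + tau by rewrite ltr_wpDr.
have yl := y_left (s + tau) _ _ cl; rewrite st0 (ltW sS) in yl; have {}yl := yl isT.
have sty : x (s + tau) = y (s + tau) by apply: yx; rewrite sS ltW.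
split; first by apply/cvg_ex; exists (lim (x u @[u --> (s + tau)^'-])).
- rewrite -sty; apply: cvg_trans cr; apply: near_eq_cvg; apply: cvg_within.
  by apply: near_yx; rewrite st0.
- rewrite (cvg_lim _ yl)// -sty xj; congr g.
  by apply: (eq_prejump tau x y S) => //; left.
Unshelve. all: by end_near. Qed.

End extension.

Lemma impulse_free_interval (S : R) : exists2 e, 0 < e &
  forall j, ~~ (S < j%:R * delta + tau < S + e).
Proof.
have exj : exists j, S < j%:R * delta + tau.
  exists (Num.truncn (`|S| / delta)).+1.
  have /andP[_] := truncn_step delta `|S| hdelta (normr_ge0 S).
  have := ler_norm S; have := htau; rewrite -natr1 mulrDl mul1r; lra.
case: (ex_minnP exj) => j Sj jmin; exists (j%:R * delta + tau - S).
  by rewrite subr_gt0.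
move=> i; rewrite subrKC; apply/negP => /andP[/jmin ji].
by rewrite ltrD2r ltr_pM2r// ltr_nat ltnNge ji.
Qed.

Lemma continuation (S : R) (c : 'rV[R]_n) : exists e (y : R -> 'rV[R]_n),
  [/\ 0 < e, forall j, ~~ (S < j%:R * delta + tau < S + e),
      forall u, 0 <= u < S -> x u = y u & y S = c] /\
  (y u @[u --> S^'+] --> y S /\
   forall t, S < t < S + e -> is_derive t 1 y (f (y t))).
Proof.
have [e1 e10 he1] := impulse_free_interval S.
have [e2 e20 [z [z0 zc dz]]] := peano f c hf.
pose y u := if u < S then x u else z (u - S).
have yE u : S <= u -> y u = z (u - S) by rewrite /y ltNge => ->.
have yS : y S = c by rewrite yE ?subrr.
exists (Num.min e1 e2), y; split; split=> //.
- by rewrite lt_min e10.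
- move=> j; apply: contra (he1 j) => /andP[-> /=] /lt_le_trans; apply.
  by rewrite lerD2l ge_min lexx.
- by move=> u /andP[_]; rewrite /y => ->.
- rewrite yS; apply/cvgrPdist_lt => eps eps0.
  have /cvgrPdist_lt/(_ _ eps0)/at_rightE[d d0 D] := zc.
  apply/at_rightE; exists d => // v /andP[Sv vd].
  rewrite (yE v (ltW Sv)); apply: D; apply/andP; split; lra.
- move=> t /andP[St te].
  have tz : 0 < t - S < e2.
    rewrite subr_gt0 St ltrBlDl (lt_le_trans te)// lerD2l ge_min lexx orbT//.
  have /is_derive1P D := dz _ tz.
  rewrite (yE t (ltW St)).
  apply/is_derive1P => eps eps0; have /nbhs_ballP[d /= d0 {}D] := D eps eps0.
  apply/nbhs_ballP; exists (Num.min d (t - S)) => /=.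
    by rewrite lt_min d0 subr_gt0.
  move=> v; rewrite /ball/= lt_min => /andP[vd vS].
  have Sv : S < v by move: vS; rewrite ltr_norml => /andP[_]; lra.
  rewrite (yE v (ltW Sv)) (yE t (ltW St)).
  have := D (v - S); rewrite /ball/=.
  have -> : t - S - (v - S) = t - v by ring.
  have -> : v - S - (t - S) = v - t by ring.
  exact.
Qed.

(** Whether an impulse is due at [S] refers to the events of a continuation still to be chosen. Two
    candidates are built, [y1] with the jump and [y2] without. An event at [S - tau] depends on the
    past only, so if [y1] has none, neither has [y2]. *)
Lemma finite_extension (S : R) : T = S%:E -> exists (S' : R) (y : R -> 'rV[R]_n),
  [/\ S < S', solution f g V a b delta tau S'%:E y x0 &
      forall u, 0 <= u -> u < S -> y u = x u].
Proof.
move=> TS; have [_ [_ _ _ _ cl]] := last_flow S TS.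
have S0 : 0 < S by rewrite -lte_fin -TS; case: hsol.
set l := lim (x u @[u --> S^'-]) in cl.
(* For [S < tau] this value has no meaning, but event times are positive, so the candidate without
   jump is then selected. *)
pose c := l + g (if tau == 0 then l else x (S - tau)).
have [e1 [y1 [[e10 ni1 yx1 yS1] [yc1 dy1]]]] := continuation S c.
have [e2 [y2 [[e20 ni2 yx2 yS2] [yc2 dy2]]]] := continuation S l.
have [[k kE]|nk] := pselect (exists k, event y1 (S + e1)%:E k = (S - tau)%:E).
  exists (S + e1), y1; split; first by rewrite ltrDl.
    apply: (extension_solution S e1 l y1) => //.
      by move=> /(_ k); rewrite kE eqxx.
    move=> i iE; rewrite yS1 /c /prejump; congr (_ + g _).
    case: eqP => [tau00|tau0].
      apply/esym/cvg_lim => //; rewrite tau00 subr0.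
      apply: cvg_trans cl; apply: near_eq_cvg; near=> u; apply: yx1.
      apply/andP; split; last by near: u; exact: nbhs_left_lt.
      by apply: ltW; near: u; exact: nbhs_left_gt.
    apply: yx1; rewrite gtrBl lt_neqAle htau andbT eq_sym; apply/andP; split; last exact/eqP.
    by apply: ltW; rewrite -lte_fin -iE event_gt0.
  by move=> u u0 uS; rewrite yx1 ?u0.
exists (S + e2), y2; split; first by rewrite ltrDl.
  apply: (extension_solution S e2 l y2) => // k kE; exfalso; apply: nk.
  have y21 u : 0 <= u < S -> y2 u = y1 u by move=> uS; rewrite -yx2// yx1.
  have Se (d : R) : 0 < d -> (S%:E < (S + d)%:E)%E by rewrite lte_fin ltrDl.
  have [tau00|tau0] := eqVneq tau 0.
    have kS : event y2 (S + e2)%:E k = S%:E by rewrite kE tau00 subr0.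
    have [i iE] := eq_event_time_at V a b delta tau hdelta htau y2 y1 S _ _ k
      y21 tau00 (Se _ e20) (Se _ e10) kS.
    by exists i; rewrite iE tau00 subr0.
  exists k; apply: (eq_event_time V a b delta tau hdelta htau y2 y1 S _ (S + e2)%:E) => //.
  - exact/ltW/Se.
  - exact/ltW/Se.
  - by rewrite gtrBl lt_def tau0.
by move=> u u0 uS; rewrite yx2 ?u0.
Unshelve. all: by end_near. Qed.

End trajectory.

(** * Global existence, stability and attractivity *)

Lemma maximal_global T x x0 : maximal_solution f g V a b delta tau T x x0 ->
  enorm x0 < r -> V x0 < a -> T = +oo%E.
Proof.
move=> [sol max] x0r x0a; have T0 : (0 < T)%E by case: sol.
case TS : T T0 => [S| |]// _; exfalso.
have [S' [y [SS' soly yx]]] := finite_extension x T x0 sol x0r x0a S TS.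
have : S'%:E = T.
  apply: (max _ y soly); rewrite TS; first by rewrite lee_fin ltW.
  by move=> t t0; rewrite lte_fin; exact: yx.
by rewrite TS => -[S'S]; move: SS'; rewrite S'S ltxx.
Qed.

Let a_lt : a < alpha1 r.
Proof.
apply: lt_le_trans abar_le; rewrite ltr_pMr// -expR0 ltr_expR.
by rewrite mulr_gt0// addr_gt0.
Qed.

Lemma V_lt_of_small c x : 0 <= c -> enorm x < r -> enorm x < Kinv alpha2 c -> V x < c.
Proof.
move=> c0 xr xc; have [_ _ _ _ /(_ x xr)[/andP[_ Vx] _ _]] := hB.
apply: le_lt_trans Vx _; rewrite -[ltRHS](KinvK _ K2)// (Kinfty_lt _ K2)//.
  exact: enorm_ge0.
exact: Kinv_ge0.
Qed.

(** [alpha1] and [alpha2] are comparable only at norms of points of the ball. If [x] were outside,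
    rescaling it to a norm [s < r] with [a <= alpha1 s] would give [a <= alpha2 s], hence
    [Kinv alpha2 a <= s < r], a contradiction. *)
Lemma initial_ball x : eball (Kinv alpha2 a) x -> enorm x < r /\ V x < a.
Proof.
rewrite /eball/= => xa.
suff xr : enorm x < r by split=> //; apply: V_lt_of_small => //; exact: ltW.
rewrite ltNge; apply/negP => rx.
have [s /andP[s0 sr] as_] := Kinfty_gap _ K1 _ _ hr a_lt.
have x0 : 0 < enorm x by exact: lt_le_trans rx.
have ws : enorm ((s / enorm x) *: x) = s.
  by rewrite enormZ ger0_norm ?divr_ge0 ?enorm_ge0// divfK// gt_eqF.
have [_ _ _ _ /(_ ((s / enorm x) *: x))[]] := hB; first by rewrite /eball/= ws.
rewrite ws => /andP[V1 V2] _ _.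
have : a <= alpha2 s by rewrite (le_trans as_)// (le_trans V1).
rewrite -{1}(KinvK _ K2 a (ltW ha)) (Kinfty_le _ K2)//; last exact: Kinv_ge0 (ltW ha).
by rewrite leNgt (lt_le_trans sr)// (le_trans rx)// ltW.
Qed.

Lemma tail_small eps : 0 < eps -> exists2 t0, 0 <= t0 & forall t, t0 <= t ->
  a * expR ((mu + b) * (tau + delta)) * expR (- (b * t)) < alpha1 eps.
Proof.
move=> eps0; have a1 := Kinfty_gt0 _ K1 _ eps0.
set C := a * _; have C0 : 0 < C by rewrite mulr_gt0// expR_gt0.
(* From this time on [b * t] is at least [C / alpha1 eps], and [1 + b * t <= expR (b * t)]. *)
exists (C / alpha1 eps / b); first by rewrite !divr_ge0// ltW.
move=> t tt; rewrite expRN ltr_pdivrMr ?expR_gt0//.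
rewrite mulrC -ltr_pdivrMr//.
apply: lt_le_trans (expR_ge1Dx _).
have : C / alpha1 eps <= t * b by rewrite -ler_pdivrMr.
lra.
Qed.

Lemma enorm_lt_of_V eps x : 0 < eps -> enorm x < r -> V x < alpha1 eps -> enorm x < eps.
Proof.
move=> eps0 xr Vx; rewrite -(Kinfty_lt _ K1) ?enorm_ge0 ?(ltW eps0)//.
by rewrite (le_lt_trans (Valpha _ xr)).
Qed.

Lemma Kinv_gt0 c : 0 < c -> 0 < Kinv alpha2 c.
Proof.
move=> c0; have [_ _ z _] := K2.
by rewrite -(Kinfty_lt _ K2) ?KinvK ?Kinv_ge0 ?(ltW c0)// z.
Qed.

(* Started close enough to the origin, the state triggers no event before the
   time [t0] from which the decaying bound is below [alpha1 eps]. *)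
Lemma stability : stable f g V a b delta tau.
Proof.
move=> eps eps0; have a1 := Kinfty_gt0 _ K1 _ eps0.
have [t0 t00 tail] := tail_small eps eps0.
(* After growth by [expR (mu * t0)], [V] is still below [alpha1 eps], which bounds the state, and
   below [thr t0], the smallest threshold up to [t0], which excludes an event. *)
pose c := Num.min (alpha1 eps) (thr t0) * expR (- (mu * t0)).
have m0 : 0 < Num.min (alpha1 eps) (thr t0) by rewrite lt_min a1 threshold_gt0.
have c0 : 0 < c by rewrite mulr_gt0// expR_gt0.
have cE : c * expR (mu * t0) = Num.min (alpha1 eps) (thr t0).
  by rewrite -mulrA -expRD addNr expR0 mulr1.
have ca : c <= a.
  rewrite /c (@le_trans _ _ (thr t0))//.
    rewrite (@le_trans _ _ (Num.min (alpha1 eps) (thr t0)))//.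
      by rewrite ger_pMr// -expR0 ler_expR oppr_le0 mulr_ge0// ltW.
    by rewrite ge_min lexx orbT.
  by rewrite ger_pMr// -expR0 ler_expR oppr_le0 mulr_ge0// ltW.
exists (Num.min r (Kinv alpha2 c)); first by rewrite lt_min hr Kinv_gt0.
move=> x0; rewrite lt_min => /andP[x0r x0c] T x mx.
have Vx0 : V x0 < c by apply: V_lt_of_small => //; exact: ltW.
have Vx0a : V x0 < a by exact: lt_le_trans ca.
have Too := maximal_global _ _ _ mx x0r Vx0a.
have [sol _] := mx.
split=> // t tge0.
have tT : (t%:E < T)%E by rewrite Too ltry.
have [xr Vx] := trajectory_bound x T x0 sol x0r Vx0a t tge0 tT.
apply: enorm_lt_of_V => //.
have [tt0|t0t] := leP t0 t; first by apply: le_lt_trans Vx _; exact: tail.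
have early u : u <= t0 -> V x0 * expR (mu * u) < Num.min (alpha1 eps) (thr t0).
  move=> ut; rewrite -cE; apply: (@lt_le_trans _ _ (c * expR (mu * u))).
    by rewrite ltr_pM2r// expR_gt0.
  by rewrite ler_pM2l// ler_expR ler_pM2l.
have no_event : (t0%:E < event x T 0)%E.
  rewrite ltNge; apply/negP => Et.
  have := event_gt0 V a b delta tau hdelta x T 0.
  case sE : (event x T 0) => [s| |]; rewrite sE// in Et * => _.
  rewrite lee_fin in Et.
  have := first_event_threshold x T x0 sol x0r Vx0a s sE.
  rewrite leNgt (lt_le_trans (early s Et))// ge_min; apply/orP; right.
  by rewrite ler_pM2l// ler_expR lerN2 ler_pM2l.
have tE : (t%:E < event x T 0)%E by rewrite (lt_trans _ no_event)// lte_fin.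
apply: le_lt_trans (early_state_bound x T x0 sol x0r Vx0a t tge0 tE tT) _.
by rewrite (lt_le_trans (early t (ltW t0t)))// ge_min lexx.
Qed.

Lemma asymptotic_stability : asymptotically_stable f g V a b delta tau.
Proof.
split; first exact: stability.
exists (Kinv alpha2 a); first exact: Kinv_gt0.
move=> x0 x0a T x mx; have [x0r Vx0] := initial_ball _ x0a.
have Too := maximal_global _ _ _ mx x0r Vx0; split=> //.
have [sol _] := mx.
apply/cvgrPdist_lt => eps eps0.
have [t0 t00 tail] := tail_small eps eps0.
exists t0; split; first exact: num_real.
move=> t /= t0t.
have tT : (t%:E < T)%E by rewrite Too ltry.
have [xr Vx] := trajectory_bound x T x0 sol x0r Vx0 t (le_trans t00 (ltW t0t)) tT.
rewrite sub0r normrN ger0_norm ?enorm_ge0//.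
apply: enorm_lt_of_V => //; apply: le_lt_trans Vx _.
by apply: tail; exact: ltW.
Qed.

End dynamics.

Theorem theorem2 (R : realType) (n : nat) (f g : 'rV[R]_n -> 'rV[R]_n)
    (tau a b delta : R) (r L1 L2 mu rho : R) (V : 'rV[R]_n -> R)
    (alpha1 alpha2 : R -> R)
    (hf : continuous f) (hf0 : f 0 = 0) (hg0 : g 0 = 0)
    (htau : 0 <= tau) (ha : 0 < a) (hb : 0 < b) (hdelta : 0 < delta)
    (hr : 0 < r)
    (hA : assumptionA f g r L1 L2)
    (hB : assumptionB f g tau r V alpha1 alpha2 mu rho)
    (hmax : Num.max (expR ((mu + b) * delta)) (expR (mu * (tau + delta)))
              <= alpha1 r / a)
    (hrho : rho * expR (b * (tau + delta)) * expR (mu * delta) < 1)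
    (hL : L2 + Num.sqrt (tau * L1 * (expR (2 * L1 * tau) - 1) / 2)
            < r / Kinv alpha1 (a * expR ((mu + b) * delta))) :
  let Gamma :=
    tau - ln (rho * expR (b * (tau + delta)) * expR (mu * delta)) / (b + mu) in
  [/\ tau < Gamma,
      forall x0 : 'rV[R]_n, eball (Kinv alpha2 a) x0 ->
        forall T x, maximal_solution f g V a b delta tau T x x0 ->
        forall k, (event_time V a b delta tau x T k.+1 < +oo)%E ->
          (Gamma%:E < event_time V a b delta tau x T k.+1
                        - event_time V a b delta tau x T k)%E &
      asymptotically_stable f g V a b delta tau].
Proof.
move=> Gamma; split.
- exact: (gap_gt_tau f g tau b delta r mu rho V alpha1 alpha2 hb hB hrho).
- move=> x0 x0a T x [sol _] k.
  have [x0r Vx0] := initial_ball f g tau a b delta r mu rho V alpha1 alpha2 ha hb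
    hdelta hr hB hmax x0 x0a.
  have := event_gt0 V a b delta tau hdelta x T k.+1.
  case sE : (event_time V a b delta tau x T k.+1) => [s| |]// _ _.
  have [s' [-> gap]] := event_gap f g tau a b delta r L1 L2 mu rho V alpha1 alpha2
    htau ha hb hdelta hr hA hB hmax hrho hL x T x0 sol x0r Vx0 k s sE.
  by rewrite -EFinB lte_fin.
- exact: (asymptotic_stability f g tau a b delta r L1 L2 mu rho V alpha1 alpha2 hf
    htau ha hb hdelta hr hA hB hmax hrho hL).
Qed.
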